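(* The set of complex extreme points of the closed unit ball of $\ell_1''$ is $\mathrm{Ext}_{\mathbb{C}}(\overline{B}_{\ell_1''})=S_{\ell_1''}$. Consequently, for any $z\in S_{\ell_1''}$ and any $\varphi\in\mathcal{M}_z$ in $\mathcal{M}(\mathcal{A}_u(B_{\ell_1}))$, the Gleason part $\mathcal{GP}(\varphi)$ does not intersect any other fiber, i.e. $\mathcal{GP}(\varphi)\cap\mathcal{M}_w=\emptyset$ for every $w\in\overline{B}_{\ell_1''}$ with $w\ne z$.
   Context: Here $\ell_1$ is the complex Banach space of absolutely summable complex sequences, $B_{\ell_1}$ its open unit ball, $\ell_1'$ its dual, $\ell_1''$ its bidual with unit sphere $S_{\ell_1''}$ and closed unit ball $\overline{B}_{\ell_1''}$. For a convex subset $C$ of a complex Banach space $X$, a point $z\in C$ is a complex extreme point of $C$ (written $z\in\mathrm{Ext}_{\mathbb{C}}(C)$) if, for $y\in X$, having $z+\lambda y\in C$ for all $\lambda\in\mathbb{C}$ with $|\lambda|\le1$ implies $y=0$. $\mathcal{A}=\mathcal{A}_u(B_{\ell_1})$ is the complex Banach algebra of all holomorphic functions $f\colon B_{\ell_1}\to\mathbb{C}$ that are uniformly continuous with respect to the norm of $\ell_1$, with the supremum norm on $B_{\ell_1}$. Its spectrum $\mathcal{M}(\mathcal{A})$ is the set of all nonzero algebra homomorphisms $\varphi\colon\mathcal{A}\to\mathbb{C}$. The (restrictions to $B_{\ell_1}$ of the) elements of $\ell_1'$ belong to $\mathcal{A}$, and $\varphi|_{\ell_1'}\in\overline{B}_{\ell_1''}$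 for each $\varphi\in\mathcal{M}(\mathcal{A})$; the fiber over $z\in\overline{B}_{\ell_1''}$ is $\mathcal{M}_z=\{\varphi\in\mathcal{M}(\mathcal{A}):\varphi|_{\ell_1'}=z\}$. For $\varphi,\psi\in\mathcal{M}(\mathcal{A})$ put $\|\varphi-\psi\|=\sup\{|\varphi(f)-\psi(f)|:f\in\mathcal{A},\ \|f\|\le1\}$. The relation $\|\varphi-\psi\|<2$ is an equivalence relation, whose classes are the Gleason parts; $\mathcal{GP}(\varphi)=\{\psi\in\mathcal{M}(\mathcal{A}):\|\varphi-\psi\|<2\}$. *)

(* Defs.v *)
From Stdlib Require Import Reals Lra Lia.
From Stdlib Require Import FunctionalExtensionality ProofIrrelevance.
From Coquelicot Require Import Coquelicot.

Open Scope R_scope.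

(* The uniform structure is the one of the metric [N (minus y x)]. *)
Section NormedOfNorm.

Context (V : ModuleSpace C_AbsRing) (N : V -> R)
  (N_plus : forall x y : V, N (plus x y) <= N x + N y)
  (N_scal : forall (a : C) (x : V), N (scal a x) <= Cmod a * N x)
  (N_eq0 : forall x : V, N x = 0 -> x = zero)
  (N_ge0 : forall x : V, 0 <= N x).

Lemma N_zero : N zero = 0.
Proof.
apply Rle_antisym; [|apply N_ge0].
pose proof (N_scal (RtoC 0) zero) as H.
rewrite (scal_zero_r (RtoC 0 : C_AbsRing)), Cmod_0 in H; lra.
Qed.

Lemma N_opp (x : V) : N (opp x) <= N x.
Proof.
pose proof (N_scal (Copp (RtoC 1)) x) as H.
rewrite Cmod_opp, Cmod_1 in H.
rewrite <- scal_opp_one; eapply Rle_trans; [exact H|]; lra.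
Qed.

Definition norm_ball (x : V) (e : R) (y : V) : Prop := N (minus y x) < e.

Lemma norm_ball_center (x : V) (e : posreal) : norm_ball x e x.
Proof.
unfold norm_ball; rewrite minus_eq_zero.
eapply Rle_lt_trans; [exact (Req_le _ _ N_zero)|apply cond_pos].
Qed.

Lemma norm_ball_sym (x y : V) (e : R) : norm_ball x e y -> norm_ball y e x.
Proof.
unfold norm_ball; intros H.
eapply Rle_lt_trans; [|exact H].
rewrite <- (opp_minus y x); apply N_opp.
Qed.

Lemma norm_ball_triangle (x y z : V) (e1 e2 : R) :
  norm_ball x e1 y -> norm_ball y e2 z -> norm_ball x (e1 + e2) z.
Proof.
unfold norm_ball; intros H1 H2.
rewrite (minus_trans y z x).
eapply Rle_lt_trans; [apply N_plus|]; lra.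
Qed.

Definition norm_UniformSpace_mixin : UniformSpace.mixin_of V :=
  UniformSpace.Mixin V zero norm_ball
    norm_ball_center norm_ball_sym norm_ball_triangle.

Definition norm_NormedModuleAux : NormedModuleAux C_AbsRing :=
  NormedModuleAux.Pack C_AbsRing V
    (NormedModuleAux.Class C_AbsRing V
       (ModuleSpace.class C_AbsRing V) norm_UniformSpace_mixin) V.

Lemma norm_compat2 (x y : norm_NormedModuleAux) (eps : posreal) :
  ball x eps y -> N (minus y x) < 1 * eps.
Proof. rewrite Rmult_1_l; exact (fun H => H). Qed.

Definition norm_NormedModule_mixin :
    NormedModule.mixin_of C_AbsRing norm_NormedModuleAux :=
  NormedModule.Mixin C_AbsRing norm_NormedModuleAux N 1 N_plus N_scal
    (fun _ _ _ H => H) norm_compat2 N_eq0.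

Definition norm_NormedModule : NormedModule C_AbsRing :=
  NormedModule.Pack C_AbsRing V
    (NormedModule.Class C_AbsRing V
       (NormedModuleAux.class C_AbsRing norm_NormedModuleAux)
       norm_NormedModule_mixin) V.

End NormedOfNorm.

(* A genuine supremum only if [f] is bounded on [P]; every norm defined from it
   below comes with a proof of boundedness. *)
Definition sup_mod {T : Type} (P : T -> Prop) (f : T -> C) : R :=
  real (Lub_Rbar (fun r => exists x, P x /\ r = Cmod (f x))).

Definition bounded_on {T : Type} (P : T -> Prop) (f : T -> C) : Prop :=
  exists M, forall x, P x -> Cmod (f x) <= M.

Section SupMod.

Context {T : Type} (P : T -> Prop) (x0 : T) (Px0 : P x0).

Lemma sup_mod_is_lub (f : T -> C) : bounded_on P f ->
  is_lub_Rbar (fun r => exists x, P x /\ r = Cmod (f x)) (sup_mod P f).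
Proof.
intros [M HM]; unfold sup_mod.
set (E := fun r => _).
pose proof (Lub_Rbar_correct E) as HL.
destruct HL as [H1 H2].
assert (HE : E (Cmod (f x0))) by (exists x0; auto).
assert (Hub : Rbar_le (Lub_Rbar E) M).
{ apply H2; intros r [x [Px ->]]; apply HM; exact Px. }
pose proof (H1 _ HE) as Hlb.
destruct (Lub_Rbar E) as [l| |]; simpl in *; try contradiction.
split; [exact H1|exact H2].
Qed.

Lemma sup_mod_ub (f : T -> C) (x : T) :
  bounded_on P f -> P x -> Cmod (f x) <= sup_mod P f.
Proof.
intros Hf Px.
apply (proj1 (sup_mod_is_lub f Hf) (Cmod (f x))); exists x; auto.
Qed.

Lemma sup_mod_le (f : T -> C) (M : R) :
  (forall x, P x -> Cmod (f x) <= M) -> sup_mod P f <= M.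
Proof.
intros HM.
apply (proj2 (sup_mod_is_lub f (ex_intro _ M HM)) M).
intros r [x [Px ->]]; apply HM; exact Px.
Qed.

Lemma sup_mod_ge0 (f : T -> C) : bounded_on P f -> 0 <= sup_mod P f.
Proof.
intros Hf; eapply Rle_trans; [apply Cmod_ge_0|exact (sup_mod_ub f x0 Hf Px0)].
Qed.

Lemma sup_mod_plus (f g : T -> C) : bounded_on P f -> bounded_on P g ->
  sup_mod P (fun x => f x + g x)%C <= sup_mod P f + sup_mod P g.
Proof.
intros Hf Hg; apply sup_mod_le; intros x Px.
eapply Rle_trans; [apply Cmod_triangle|].
apply Rplus_le_compat; apply sup_mod_ub; assumption.
Qed.

Lemma sup_mod_scal (a : C) (f : T -> C) : bounded_on P f ->
  sup_mod P (fun x => a * f x)%C <= Cmod a * sup_mod P f.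
Proof.
intros Hf; apply sup_mod_le; intros x Px.
rewrite Cmod_mult; apply Rmult_le_compat_l; [apply Cmod_ge_0|].
apply sup_mod_ub; assumption.
Qed.

Lemma sup_mod_eq0 (f : T -> C) : bounded_on P f ->
  sup_mod P f = 0 -> forall x, P x -> f x = 0%C.
Proof.
intros Hf H0 x Px; apply Cmod_eq_0, Rle_antisym; [|apply Cmod_ge_0].
rewrite <- H0; apply sup_mod_ub; assumption.
Qed.

End SupMod.

Record l1 : Type := L1 {
  l1_seq :> nat -> C;
  l1_summable : ex_series (fun n => Cmod (l1_seq n)) }.

Lemma l1_ext (x y : l1) : (forall n, x n = y n) -> x = y.
Proof.
destruct x as [x Hx], y as [y Hy]; simpl; intros H.
assert (E : x = y) by (apply functional_extensionality; exact H).
subst y; f_equal; apply proof_irrelevance.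
Qed.

Lemma l1_plus_summable (x y : l1) : ex_series (fun n => Cmod (x n + y n)%C).
Proof.
apply (ex_series_le (K := R_AbsRing) (V := R_CompleteNormedModule)
         _ (fun n => Cmod (x n) + Cmod (y n))).
- intros n; change (Rabs (Cmod (x n + y n)%C) <= Cmod (x n) + Cmod (y n)).
  rewrite Rabs_pos_eq; [apply Cmod_triangle|apply Cmod_ge_0].
- apply (ex_series_plus (fun n => Cmod (x n)) (fun n => Cmod (y n)));
    apply l1_summable.
Qed.

Lemma l1_scal_summable (a : C) (x : l1) : ex_series (fun n => Cmod (a * x n)%C).
Proof.
apply ex_series_ext with (fun n => scal (Cmod a) (Cmod (x n))).
- intros n; rewrite Cmod_mult; reflexivity.
- apply (ex_series_scal_l (Cmod a) (fun n => Cmod (x n))), l1_summable.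
Qed.

Lemma l1_zero_summable : ex_series (fun _ : nat => Cmod 0%C).
Proof.
exists 0; rewrite Cmod_0.
change (is_lim_seq (sum_n (fun _ : nat => 0)) 0).
apply (is_lim_seq_ext (fun _ => 0)); [|apply is_lim_seq_const].
intros n; rewrite sum_n_const; ring.
Qed.

Definition l1_plus (x y : l1) : l1 := L1 _ (l1_plus_summable x y).
Definition l1_scal (a : C) (x : l1) : l1 := L1 _ (l1_scal_summable a x).
Definition l1_zero : l1 := L1 _ l1_zero_summable.
Definition l1_opp (x : l1) : l1 := l1_scal (-1)%C x.

Lemma l1_plus_comm (x y : l1) : l1_plus x y = l1_plus y x.
Proof. apply l1_ext; intros n; simpl; ring. Qed.
Lemma l1_plus_assoc (x y z : l1) :
  l1_plus x (l1_plus y z) = l1_plus (l1_plus x y) z.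
Proof. apply l1_ext; intros n; simpl; ring. Qed.
Lemma l1_plus_zero (x : l1) : l1_plus x l1_zero = x.
Proof. apply l1_ext; intros n; simpl; ring. Qed.
Lemma l1_plus_opp (x : l1) : l1_plus x (l1_opp x) = l1_zero.
Proof. apply l1_ext; intros n; simpl; ring. Qed.

Canonical l1_AbelianMonoid := AbelianMonoid.Pack l1
  (AbelianMonoid.Mixin l1 l1_plus l1_zero
     l1_plus_comm l1_plus_assoc l1_plus_zero) l1.
Canonical l1_AbelianGroup := AbelianGroup.Pack l1
  (AbelianGroup.Class l1 (AbelianMonoid.class l1_AbelianMonoid)
     (AbelianGroup.Mixin l1_AbelianMonoid l1_opp l1_plus_opp)) l1.

Lemma l1_scal_assoc (a b : C) (x : l1) :
  l1_scal a (l1_scal b x) = l1_scal (a * b)%C x.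
Proof. apply l1_ext; intros n; simpl; ring. Qed.
Lemma l1_scal_one (x : l1) : l1_scal 1%C x = x.
Proof. apply l1_ext; intros n; simpl; ring. Qed.
Lemma l1_scal_plus_l (a : C) (x y : l1) :
  l1_scal a (l1_plus x y) = l1_plus (l1_scal a x) (l1_scal a y).
Proof. apply l1_ext; intros n; simpl; ring. Qed.
Lemma l1_scal_plus_r (a b : C) (x : l1) :
  l1_scal (a + b)%C x = l1_plus (l1_scal a x) (l1_scal b x).
Proof. apply l1_ext; intros n; simpl; ring. Qed.

Canonical l1_ModuleSpace := ModuleSpace.Pack C_AbsRing l1
  (ModuleSpace.Class C_AbsRing l1 (AbelianGroup.class l1_AbelianGroup)
     (ModuleSpace.Mixin C_AbsRing l1_AbelianGroup l1_scal
        l1_scal_assoc l1_scal_one l1_scal_plus_l l1_scal_plus_r)) l1.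

Definition l1_norm (x : l1) : R := Series (fun n => Cmod (x n)).

Lemma l1_norm_ge0 (x : l1) : 0 <= l1_norm x.
Proof.
unfold l1_norm.
rewrite <- (Rmult_0_l (Series (fun n => Cmod (x n)))), <- Series_scal_l.
apply Series_le; [|apply l1_summable].
intros n; pose proof (Cmod_ge_0 (x n)); lra.
Qed.

Lemma l1_norm_plus (x y : l1) : l1_norm (l1_plus x y) <= l1_norm x + l1_norm y.
Proof.
unfold l1_norm; rewrite <- Series_plus by apply l1_summable.
apply Series_le.
- intros n; split; [apply Cmod_ge_0|apply Cmod_triangle].
- apply (ex_series_plus (fun n => Cmod (x n)) (fun n => Cmod (y n)));
    apply l1_summable.
Qed.

Lemma l1_norm_scal (a : C) (x : l1) : l1_norm (l1_scal a x) <= Cmod a * l1_norm x.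
Proof.
unfold l1_norm; rewrite <- Series_scal_l; apply Req_le, Series_ext.
intros n; apply Cmod_mult.
Qed.

Lemma l1_norm_coord (x : l1) (n : nat) : Cmod (x n) <= l1_norm x.
Proof.
unfold l1_norm.
rewrite (Series_incr_n _ (S n)) by (try lia; apply l1_summable).
assert (H1 : 0 <= Series (fun k => Cmod (x (S n + k)%nat))).
{ rewrite <- (Rmult_0_l (Series (fun k => Cmod (x (S n + k)%nat)))),
    <- Series_scal_l.
  apply Series_le.
  - intros k; pose proof (Cmod_ge_0 (x (S n + k)%nat)); lra.
  - apply (ex_series_incr_n (fun k => Cmod (x k))), l1_summable. }
simpl pred.
assert (H2 : forall m, 0 <= sum_f_R0 (fun k => Cmod (x k)) m).
{ intros m; apply cond_pos_sum; intros k; apply Cmod_ge_0. }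
assert (H3 : Cmod (x n) <= sum_f_R0 (fun k => Cmod (x k)) n).
{ destruct n as [|m]; simpl; [lra|]; pose proof (H2 m); lra. }
lra.
Qed.

Lemma l1_norm_eq0 (x : l1) : l1_norm x = 0 -> x = l1_zero.
Proof.
intros H; apply l1_ext; intros n; apply Cmod_eq_0, Rle_antisym.
- rewrite <- H; apply l1_norm_coord.
- apply Cmod_ge_0.
Qed.

Definition l1_NormedModule_of_norm : NormedModule C_AbsRing :=
  norm_NormedModule l1_ModuleSpace l1_norm
    l1_norm_plus l1_norm_scal l1_norm_eq0 l1_norm_ge0.
Canonical l1_UniformSpace := UniformSpace.Pack l1
  (UniformSpace.class l1_NormedModule_of_norm) l1.
Canonical l1_NormedModuleAux := NormedModuleAux.Pack C_AbsRing l1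
  (NormedModuleAux.class C_AbsRing l1_NormedModule_of_norm) l1.
Canonical l1_NormedModule := NormedModule.Pack C_AbsRing l1
  (NormedModule.class C_AbsRing l1_NormedModule_of_norm) l1.

Section Dual.

Context (V : NormedModule C_AbsRing).

(* [is_linear] includes boundedness. *)
Record dual : Type := Dual {
  dual_fun :> V -> C;
  dual_linear : is_linear dual_fun }.

Lemma dual_ext (f g : dual) : (forall x, f x = g x) -> f = g.
Proof.
destruct f as [f Hf], g as [g Hg]; simpl; intros H.
assert (E : f = g) by (apply functional_extensionality; exact H).
subst g; f_equal; apply proof_irrelevance.
Qed.

Lemma dual_add (f : dual) (x y : V) : f (plus x y) = (f x + f y)%C.
Proof. exact (linear_plus _ (dual_linear f) x y). Qed.

Lemma dual_mul (f : dual) (a : C) (x : V) : f (scal a x) = (a * f x)%C.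
Proof. exact (linear_scal _ (dual_linear f) a x). Qed.

Lemma dual_bound (f : dual) :
  exists M, 0 < M /\ forall x, Cmod (f x) <= M * norm x.
Proof. exact (linear_norm _ (dual_linear f)). Qed.

Lemma dual_plus_linear (f g : dual) : is_linear (fun x : V => f x + g x)%C.
Proof.
split.
- intros x y; rewrite !dual_add.
  change (f x + f y + (g x + g y) = f x + g x + (f y + g y))%C; ring.
- intros a x; rewrite !dual_mul.
  change (a * f x + a * g x = a * (f x + g x))%C; ring.
- destruct (dual_bound f) as [M [HM Hf]], (dual_bound g) as [M' [HM' Hg]].
  exists (M + M'); split; [lra|intros x].
  change (Cmod (f x + g x)%C <= (M + M') * norm x).
  pose proof (Cmod_triangle (f x) (g x)); pose proof (Hf x); pose proof (Hg x).
  lra.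
Qed.

Lemma dual_scal_linear (a : C) (f : dual) : is_linear (fun x : V => a * f x)%C.
Proof.
split.
- intros x y; rewrite !dual_add.
  change (a * (f x + f y) = a * f x + a * f y)%C; ring.
- intros b x; rewrite !dual_mul.
  change (a * (b * f x) = b * (a * f x))%C; ring.
- destruct (dual_bound f) as [M [HM Hf]].
  pose proof (Cmod_ge_0 a) as Ha.
  exists ((Cmod a + 1) * M); split; [apply Rmult_lt_0_compat; lra|intros x].
  change (Cmod (a * f x)%C <= (Cmod a + 1) * M * norm x).
  rewrite Cmod_mult, Rmult_assoc.
  apply Rmult_le_compat; [lra|apply Cmod_ge_0|lra|apply Hf].
Qed.

Lemma dual_zero_linear : is_linear (fun _ : V => RtoC 0).
Proof. exact (is_linear_zero (K := C_AbsRing) (U := V) (V := C_NormedModule)). Qed.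

Definition dual_plus (f g : dual) : dual := Dual _ (dual_plus_linear f g).
Definition dual_scal (a : C) (f : dual) : dual := Dual _ (dual_scal_linear a f).
Definition dual_zero : dual := Dual _ dual_zero_linear.
Definition dual_opp (f : dual) : dual := dual_scal (-1)%C f.

Lemma dual_plus_comm (f g : dual) : dual_plus f g = dual_plus g f.
Proof. apply dual_ext; intros x; simpl; ring. Qed.
Lemma dual_plus_assoc (f g h : dual) :
  dual_plus f (dual_plus g h) = dual_plus (dual_plus f g) h.
Proof. apply dual_ext; intros x; simpl; ring. Qed.
Lemma dual_plus_zero (f : dual) : dual_plus f dual_zero = f.
Proof. apply dual_ext; intros x; simpl; ring. Qed.
Lemma dual_plus_opp (f : dual) : dual_plus f (dual_opp f) = dual_zero.
Proof. apply dual_ext; intros x; simpl; ring. Qed.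

Canonical dual_AbelianMonoid := AbelianMonoid.Pack dual
  (AbelianMonoid.Mixin dual dual_plus dual_zero
     dual_plus_comm dual_plus_assoc dual_plus_zero) dual.
Canonical dual_AbelianGroup := AbelianGroup.Pack dual
  (AbelianGroup.Class dual (AbelianMonoid.class dual_AbelianMonoid)
     (AbelianGroup.Mixin dual_AbelianMonoid dual_opp dual_plus_opp)) dual.

Lemma dual_scal_assoc (a b : C) (f : dual) :
  dual_scal a (dual_scal b f) = dual_scal (a * b)%C f.
Proof. apply dual_ext; intros x; simpl; ring. Qed.
Lemma dual_scal_one (f : dual) : dual_scal 1%C f = f.
Proof. apply dual_ext; intros x; simpl; ring. Qed.
Lemma dual_scal_plus_l (a : C) (f g : dual) :
  dual_scal a (dual_plus f g) = dual_plus (dual_scal a f) (dual_scal a g).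
Proof. apply dual_ext; intros x; simpl; ring. Qed.
Lemma dual_scal_plus_r (a b : C) (f : dual) :
  dual_scal (a + b)%C f = dual_plus (dual_scal a f) (dual_scal b f).
Proof. apply dual_ext; intros x; simpl; ring. Qed.

Canonical dual_ModuleSpace := ModuleSpace.Pack C_AbsRing dual
  (ModuleSpace.Class C_AbsRing dual (AbelianGroup.class dual_AbelianGroup)
     (ModuleSpace.Mixin C_AbsRing dual_AbelianGroup dual_scal
        dual_scal_assoc dual_scal_one dual_scal_plus_l dual_scal_plus_r)) dual.

Definition dual_norm (f : dual) : R := sup_mod (fun x : V => norm x <= 1) f.

Lemma norm_zero_le1 : norm (zero : V) <= 1.
Proof. rewrite norm_zero; lra. Qed.

Lemma dual_bounded (f : dual) : bounded_on (fun x : V => norm x <= 1) f.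
Proof.
destruct (dual_bound f) as [M [HM Hf]]; exists M; intros x Hx.
eapply Rle_trans; [apply Hf|].
rewrite <- (Rmult_1_r M) at 2; apply Rmult_le_compat_l; lra.
Qed.

Lemma dual_norm_plus (f g : dual) :
  dual_norm (dual_plus f g) <= dual_norm f + dual_norm g.
Proof.
apply (sup_mod_plus _ zero norm_zero_le1 f g); apply dual_bounded.
Qed.

Lemma dual_norm_scal (a : C) (f : dual) :
  dual_norm (dual_scal a f) <= Cmod a * dual_norm f.
Proof. apply (sup_mod_scal _ zero norm_zero_le1 a f), dual_bounded. Qed.

Lemma dual_norm_ge0 (f : dual) : 0 <= dual_norm f.
Proof. apply (sup_mod_ge0 _ zero norm_zero_le1), dual_bounded. Qed.

Lemma dual_norm_eq0 (f : dual) : dual_norm f = 0 -> f = dual_zero.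
Proof.
intros H; apply dual_ext; intros x; simpl.
set (t := / (norm x + 1)).
pose proof (norm_ge_0 x) as Hx.
assert (Ht : 0 < t) by (apply Rinv_0_lt_compat; lra).
assert (Htx : norm (scal (RtoC t : C_AbsRing) x) <= 1).
{ eapply Rle_trans; [apply (norm_scal (RtoC t : C_AbsRing) x)|].
  change (Cmod (RtoC t) * norm x <= 1).
  rewrite Cmod_R, Rabs_pos_eq by lra.
  apply Rmult_le_reg_l with (norm x + 1); [lra|].
  unfold t; rewrite <- Rmult_assoc, Rinv_r by lra; lra. }
pose proof (sup_mod_eq0 _ zero norm_zero_le1 f (dual_bounded f) H _ Htx) as E.
apply (eq_trans (eq_sym (dual_mul f (RtoC t) x))) in E.
apply Cmod_eq_0; apply (f_equal Cmod) in E.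
rewrite Cmod_mult, Cmod_0, Cmod_R, Rabs_pos_eq in E by lra.
apply Rmult_integral in E; destruct E; lra.
Qed.

Definition dual_NormedModule_of_norm : NormedModule C_AbsRing :=
  norm_NormedModule dual_ModuleSpace dual_norm
    dual_norm_plus dual_norm_scal dual_norm_eq0 dual_norm_ge0.
Canonical dual_UniformSpace := UniformSpace.Pack dual
  (UniformSpace.class dual_NormedModule_of_norm) dual.
Canonical dual_NormedModuleAux := NormedModuleAux.Pack C_AbsRing dual
  (NormedModuleAux.class C_AbsRing dual_NormedModule_of_norm) dual.
Canonical dual_NormedModule := NormedModule.Pack C_AbsRing dual
  (NormedModule.class C_AbsRing dual_NormedModule_of_norm) dual.

End Dual.

Arguments dual_ext {V} f g _.
Arguments dual_add {V} f x y.
Arguments dual_mul {V} f a x.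
Arguments dual_bound {V} f.

Section UniformAlgebra.

Context (V : NormedModule C_AbsRing).

Definition unit_ball : Type := {x : V | norm x < 1}.

Definition ball_pt (x : unit_ball) : V := proj1_sig x.
Coercion ball_pt : unit_ball >-> NormedModule.sort.

Definition extend (f : unit_ball -> C) (x : V) : C :=
  match Rlt_dec (norm x) 1 with
  | left Hx => f (exist _ x Hx)
  | right _ => 0%C
  end.

(* Complex Frechet differentiability at every point of the open ball, where the
   extension by zero plays no role. *)
Definition holomorphic (f : unit_ball -> C) : Prop :=
  forall x : unit_ball,
    ex_filterdiff (K := C_AbsRing) (extend f) (locally (ball_pt x)).

Definition uniformly_continuous (f : unit_ball -> C) : Prop :=
  forall eps : posreal, exists delta : posreal, forall x y : unit_ball,
    norm (minus (ball_pt y) (ball_pt x)) < delta -> Cmod (f y - f x)%C < eps.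

Record Au : Type := MkAu {
  Au_fun :> unit_ball -> C;
  Au_holomorphic : holomorphic Au_fun;
  Au_uniformly_continuous : uniformly_continuous Au_fun }.

Lemma Au_ext (f g : Au) : (forall x, f x = g x) -> f = g.
Proof.
destruct f as [f Hf Hf'], g as [g Hg Hg']; simpl; intros H.
assert (E : f = g) by (apply functional_extensionality; exact H).
subst g; f_equal; apply proof_irrelevance.
Qed.

Lemma extend_in (f : unit_ball -> C) (x : unit_ball) : extend f x = f x.
Proof.
destruct x as [x Hx]; unfold extend; simpl.
destruct (Rlt_dec (norm x) 1) as [H|H]; [|contradiction].
f_equal; f_equal; apply proof_irrelevance.
Qed.

Lemma plus_minus_cancel (x y : V) : plus (minus y x) x = y.
Proof.
unfold minus; rewrite <- plus_assoc, plus_opp_l, plus_zero_r; reflexivity.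
Qed.

Lemma locally_unit_ball (x : unit_ball) :
  locally (ball_pt x) (fun y => norm y < 1).
Proof.
apply locally_le_locally_norm.
destruct x as [x Hx]; simpl.
assert (H : 0 < 1 - norm x) by lra.
exists (mkposreal _ H); unfold ball_norm; simpl; intros y Hy.
pose proof (norm_triangle (minus y x) x) as Ht.
pose proof (plus_minus_cancel x y) as E.
apply (Rle_trans _ _ _ (Req_le _ _ (f_equal norm (eq_sym E)))) in Ht; lra.
Qed.

Lemma holomorphic_of (F : V -> C) (f : unit_ball -> C) :
  (forall x : unit_ball, F x = f x) ->
  (forall x : unit_ball,
     ex_filterdiff (K := C_AbsRing) F (locally (ball_pt x))) ->
  holomorphic f.
Proof.
intros Ff HF x; destruct (HF x) as [l Hl]; exists l.
eapply filterdiff_ext_locally; [|exact Hl].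
apply (filter_imp (fun y => norm y < 1)); [|apply locally_unit_ball].
intros y Hy; change y with (ball_pt (exist _ y Hy)).
rewrite extend_in; apply Ff.
Qed.

Definition unit_ball_zero : unit_ball.
Proof. exists zero; rewrite norm_zero; apply Rlt_0_1. Defined.

Lemma uniformly_continuous_bounded (f : unit_ball -> C) :
  uniformly_continuous f -> bounded_on (fun _ => True) f.
Proof.
intros Hf; destruct (Hf (mkposreal 1 Rlt_0_1)) as [delta Hd]; simpl in Hd.
destruct (archimed_cor1 delta (cond_pos delta)) as [n [Hn Hn0]].
assert (Hn' : 0 < INR n) by (apply lt_0_INR; exact Hn0).
assert (Hinv : 0 < / INR n) by (apply Rinv_0_lt_compat; exact Hn').
exists (Cmod (f unit_ball_zero) + INR n); intros [x Hx] _.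
assert (Hs : forall t : R, 0 <= t ->
  norm (scal (RtoC t : C_AbsRing) x) <= t * norm x).
{ intros t Ht; eapply Rle_trans; [apply (norm_scal (RtoC t : C_AbsRing) x)|].
  change (Cmod (RtoC t) * norm x <= t * norm x).
  rewrite Cmod_R, Rabs_pos_eq by exact Ht; lra. }
assert (Hx0 := norm_ge_0 x).
assert (Hk : forall k, (k <= n)%nat ->
  exists p : unit_ball,
    ball_pt p = scal (RtoC (INR k / INR n) : C_AbsRing) x /\
    Cmod (f p) <= Cmod (f unit_ball_zero) + INR k).
{ induction k as [|k IH]; intros Hkn.
  - exists unit_ball_zero; split; [|simpl; lra].
    simpl INR; unfold Rdiv; rewrite Rmult_0_l; symmetry.
    apply (scal_zero_l (K := C_AbsRing) x).
  - destruct IH as [p [Hp Hfp]]; [lia|].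
    assert (H0 : 0 <= INR (S k) / INR n <= 1).
    { split; [apply Rle_mult_inv_pos; [apply pos_INR|exact Hn']|].
      apply Rmult_le_reg_r with (INR n); [exact Hn'|].
      unfold Rdiv; rewrite Rmult_assoc, Rinv_l, Rmult_1_r, Rmult_1_l by lra.
      apply le_INR; exact Hkn. }
    assert (Hq : norm (scal (RtoC (INR (S k) / INR n) : C_AbsRing) x) < 1).
    { eapply Rle_lt_trans; [apply Hs; apply H0|].
      apply Rle_lt_trans with (1 * norm x); [|lra].
      apply Rmult_le_compat_r; [exact Hx0|apply H0]. }
    set (q := exist (fun y : V => norm y < 1) _ Hq : unit_ball).
    exists q; split; [reflexivity|].
    assert (Hd' : Cmod (f q - f p)%C < 1).
    { apply Hd; rewrite Hp; simpl ball_pt.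
      assert (E : minus (RtoC (INR (S k) / INR n) : C_AbsRing)
                    (RtoC (INR k / INR n) : C_AbsRing) = RtoC (/ INR n)).
      { change (RtoC (INR (S k) / INR n) - RtoC (INR k / INR n)
                  = RtoC (/ INR n))%C.
        rewrite <- RtoC_minus; f_equal; rewrite S_INR; field; lra. }
      pose proof (scal_minus_distr_r
        (V := NormedModule.ModuleSpace C_AbsRing V)
        (RtoC (INR (S k) / INR n) : C_AbsRing)
        (RtoC (INR k / INR n) : C_AbsRing) x) as E2.
      apply eq_sym in E2.
      apply (fun e => eq_trans e
               (f_equal (fun c : C => scal (c : C_AbsRing) x) E)) in E2.
      apply (f_equal norm), Req_le in E2.
      eapply Rle_lt_trans; [exact E2|].
      eapply Rle_lt_trans; [apply Hs; lra|].
      apply Rle_lt_trans with (/ INR n * 1); [|lra].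
      apply Rmult_le_compat_l; lra. }
    rewrite S_INR.
    pose proof (Cmod_triangle (f q - f p)%C (f p)) as Ht.
    replace (f q - f p + f p)%C with (f q) in Ht by ring; lra. }
destruct (Hk n (le_n n)) as [p [Hp Hfp]].
assert (Epx : ball_pt p = x).
{ rewrite Hp.
  replace (RtoC (INR n / INR n) : C_AbsRing) with (one : C_AbsRing).
  - apply (scal_one (V := NormedModule.ModuleSpace C_AbsRing V)).
  - change (RtoC 1 = RtoC (INR n / INR n)); f_equal; field; lra. }
clear Hp; destruct p as [p Hp']; simpl in Epx; subst p.
rewrite (proof_irrelevance _ Hx Hp'); exact Hfp.
Qed.

Lemma Au_bounded (f : Au) : bounded_on (fun _ => True) f.
Proof. apply uniformly_continuous_bounded, Au_uniformly_continuous. Qed.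

Lemma Au_plus_holo (f g : Au) : holomorphic (fun x => f x + g x)%C.
Proof.
apply holomorphic_of with (fun x => extend f x + extend g x)%C.
- intros x; rewrite !extend_in; reflexivity.
- intros x.
  destruct (Au_holomorphic f x) as [l Hl], (Au_holomorphic g x) as [m Hm].
  exists (fun y => plus (l y) (m y)).
  exact (filterdiff_plus_fct _ _ _ _ Hl Hm).
Qed.

Lemma Au_plus_unif (f g : Au) : uniformly_continuous (fun x => f x + g x)%C.
Proof.
intros eps.
assert (He : 0 < eps / 2) by (pose proof (cond_pos eps); lra).
destruct (Au_uniformly_continuous f (mkposreal _ He)) as [d Hd].
destruct (Au_uniformly_continuous g (mkposreal _ He)) as [d' Hd'].
simpl in Hd, Hd'.
assert (Hm : 0 < Rmin d d') by (apply Rmin_pos; apply cond_pos).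
exists (mkposreal _ Hm); simpl; intros x y Hxy.
replace (f y + g y - (f x + g x))%C with ((f y - f x) + (g y - g x))%C by ring.
eapply Rle_lt_trans; [apply Cmod_triangle|].
pose proof (Hd x y (Rlt_le_trans _ _ _ Hxy (Rmin_l _ _))).
pose proof (Hd' x y (Rlt_le_trans _ _ _ Hxy (Rmin_r _ _))).
lra.
Qed.

(* Coquelicot has two instances of [C] as a normed module over itself, which
   differ only in the uniform structure (product structure or metric). *)
Lemma filterdiff_C_AbsRing (F : V -> C) (G : (V -> Prop) -> Prop) (l : V -> C) :
  filterdiff (K := C_AbsRing) (V := C_NormedModule) F G l <->
  filterdiff (K := C_AbsRing) (V := AbsRing_NormedModule C_AbsRing) F G l.
Proof.
split; intros [[H1 H2 H3] H]; (split; [split; assumption|exact H]).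
Qed.

Lemma Au_mult_holo (f g : Au) : holomorphic (fun x => f x * g x)%C.
Proof.
apply holomorphic_of with (fun x => extend f x * extend g x)%C.
- intros x; rewrite !extend_in; reflexivity.
- intros x.
  destruct (Au_holomorphic f x) as [l Hl], (Au_holomorphic g x) as [m Hm].
  eexists; apply filterdiff_C_AbsRing.
  exact (filterdiff_mult_fct (K := C_AbsRing) (extend f) (extend g) (ball_pt x)
           l m Cmult_comm (proj1 (filterdiff_C_AbsRing _ _ _) Hl)
           (proj1 (filterdiff_C_AbsRing _ _ _) Hm)).
Qed.

Lemma Au_mult_unif (f g : Au) : uniformly_continuous (fun x => f x * g x)%C.
Proof.
destruct (Au_bounded f) as [M HM], (Au_bounded g) as [M' HM'].
intros eps.
pose proof (HM unit_ball_zero I) as H0; pose proof (HM' unit_ball_zero I) as H0'.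
pose proof (Cmod_ge_0 (f unit_ball_zero)).
pose proof (Cmod_ge_0 (g unit_ball_zero)).
set (D := M + M' + 1).
assert (HD : 0 < D) by (unfold D; lra).
assert (He : 0 < eps / D) by (apply Rdiv_lt_0_compat; [apply cond_pos|exact HD]).
destruct (Au_uniformly_continuous f (mkposreal _ He)) as [d Hd].
destruct (Au_uniformly_continuous g (mkposreal _ He)) as [d' Hd'].
simpl in Hd, Hd'.
assert (Hm : 0 < Rmin d d') by (apply Rmin_pos; apply cond_pos).
exists (mkposreal _ Hm); simpl; intros x y Hxy.
replace (f y * g y - f x * g x)%C
  with (f y * (g y - g x) + (f y - f x) * g x)%C by ring.
eapply Rle_lt_trans; [apply Cmod_triangle|].
rewrite !Cmod_mult.
pose proof (Hd x y (Rlt_le_trans _ _ _ Hxy (Rmin_l _ _))) as E1.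
pose proof (Hd' x y (Rlt_le_trans _ _ _ Hxy (Rmin_r _ _))) as E2.
pose proof (HM y I); pose proof (HM' x I).
assert (E3 : Cmod (f y) * Cmod (g y - g x)%C <= M * (eps / D)).
{ apply Rmult_le_compat; try apply Cmod_ge_0; lra. }
assert (E4 : Cmod (f y - f x)%C * Cmod (g x) <= (eps / D) * M').
{ apply Rmult_le_compat; try apply Cmod_ge_0; lra. }
assert (E5 : pos eps = eps / D * D) by (field; lra).
rewrite E5; unfold D at 2; lra.
Qed.

Lemma Au_const_holo (c : C) : holomorphic (fun _ => c).
Proof.
apply holomorphic_of with (fun _ => c); [reflexivity|].
intros x; exists (fun _ => zero).
apply (filterdiff_const (K := C_AbsRing) (V := C_NormedModule)).
Qed.

Lemma Au_const_unif (c : C) : uniformly_continuous (fun _ => c).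
Proof.
intros eps; exists eps; intros x y _.
replace (c - c)%C with (RtoC 0) by ring; rewrite Cmod_0; apply cond_pos.
Qed.

Definition Au_const (c : C) : Au := MkAu _ (Au_const_holo c) (Au_const_unif c).
Definition Au_plus (f g : Au) : Au := MkAu _ (Au_plus_holo f g) (Au_plus_unif f g).
Definition Au_mult (f g : Au) : Au := MkAu _ (Au_mult_holo f g) (Au_mult_unif f g).
Definition Au_zero : Au := Au_const 0%C.
Definition Au_one : Au := Au_const 1%C.
Definition Au_scal (c : C) (f : Au) : Au := Au_mult (Au_const c) f.
Definition Au_opp (f : Au) : Au := Au_scal (-1)%C f.

Lemma Au_plus_comm (f g : Au) : Au_plus f g = Au_plus g f.
Proof. apply Au_ext; intros x; simpl; ring. Qed.
Lemma Au_plus_assoc (f g h : Au) :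
  Au_plus f (Au_plus g h) = Au_plus (Au_plus f g) h.
Proof. apply Au_ext; intros x; simpl; ring. Qed.
Lemma Au_plus_zero (f : Au) : Au_plus f Au_zero = f.
Proof. apply Au_ext; intros x; simpl; ring. Qed.
Lemma Au_plus_opp (f : Au) : Au_plus f (Au_opp f) = Au_zero.
Proof. apply Au_ext; intros x; simpl; ring. Qed.

Canonical Au_AbelianMonoid := AbelianMonoid.Pack Au
  (AbelianMonoid.Mixin Au Au_plus Au_zero
     Au_plus_comm Au_plus_assoc Au_plus_zero) Au.
Canonical Au_AbelianGroup := AbelianGroup.Pack Au
  (AbelianGroup.Class Au (AbelianMonoid.class Au_AbelianMonoid)
     (AbelianGroup.Mixin Au_AbelianMonoid Au_opp Au_plus_opp)) Au.

Lemma Au_mult_assoc (f g h : Au) :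
  Au_mult f (Au_mult g h) = Au_mult (Au_mult f g) h.
Proof. apply Au_ext; intros x; simpl; ring. Qed.
Lemma Au_mult_one_r (f : Au) : Au_mult f Au_one = f.
Proof. apply Au_ext; intros x; simpl; ring. Qed.
Lemma Au_mult_one_l (f : Au) : Au_mult Au_one f = f.
Proof. apply Au_ext; intros x; simpl; ring. Qed.
Lemma Au_mult_distr_r (f g h : Au) :
  Au_mult (Au_plus f g) h = Au_plus (Au_mult f h) (Au_mult g h).
Proof. apply Au_ext; intros x; simpl; ring. Qed.
Lemma Au_mult_distr_l (f g h : Au) :
  Au_mult f (Au_plus g h) = Au_plus (Au_mult f g) (Au_mult f h).
Proof. apply Au_ext; intros x; simpl; ring. Qed.

Canonical Au_Ring := Ring.Pack Au
  (Ring.Class Au (AbelianGroup.class Au_AbelianGroup)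
     (Ring.Mixin Au_AbelianGroup Au_mult Au_one Au_mult_assoc
        Au_mult_one_r Au_mult_one_l Au_mult_distr_r Au_mult_distr_l)) Au.

Lemma Au_scal_assoc (a b : C) (f : Au) :
  Au_scal a (Au_scal b f) = Au_scal (a * b)%C f.
Proof. apply Au_ext; intros x; simpl; ring. Qed.
Lemma Au_scal_one (f : Au) : Au_scal 1%C f = f.
Proof. apply Au_ext; intros x; simpl; ring. Qed.
Lemma Au_scal_plus_l (a : C) (f g : Au) :
  Au_scal a (Au_plus f g) = Au_plus (Au_scal a f) (Au_scal a g).
Proof. apply Au_ext; intros x; simpl; ring. Qed.
Lemma Au_scal_plus_r (a b : C) (f : Au) :
  Au_scal (a + b)%C f = Au_plus (Au_scal a f) (Au_scal b f).
Proof. apply Au_ext; intros x; simpl; ring. Qed.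

Canonical Au_ModuleSpace := ModuleSpace.Pack C_AbsRing Au
  (ModuleSpace.Class C_AbsRing Au (AbelianGroup.class Au_AbelianGroup)
     (ModuleSpace.Mixin C_AbsRing Au_AbelianGroup Au_scal
        Au_scal_assoc Au_scal_one Au_scal_plus_l Au_scal_plus_r)) Au.

Definition Au_norm (f : Au) : R := sup_mod (fun _ => True) f.

Lemma Au_norm_plus (f g : Au) : Au_norm (Au_plus f g) <= Au_norm f + Au_norm g.
Proof. apply (sup_mod_plus _ unit_ball_zero I f g); apply Au_bounded. Qed.

Lemma Au_norm_scal (a : C) (f : Au) :
  Au_norm (Au_scal a f) <= Cmod a * Au_norm f.
Proof. apply (sup_mod_scal _ unit_ball_zero I a f), Au_bounded. Qed.

Lemma Au_norm_ge0 (f : Au) : 0 <= Au_norm f.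
Proof. apply (sup_mod_ge0 _ unit_ball_zero I), Au_bounded. Qed.

Lemma Au_norm_eq0 (f : Au) : Au_norm f = 0 -> f = Au_zero.
Proof.
intros H; apply Au_ext; intros x.
exact (sup_mod_eq0 _ unit_ball_zero I f (Au_bounded f) H x I).
Qed.

Definition Au_NormedModule_of_norm : NormedModule C_AbsRing :=
  norm_NormedModule Au_ModuleSpace Au_norm
    Au_norm_plus Au_norm_scal Au_norm_eq0 Au_norm_ge0.
Canonical Au_UniformSpace := UniformSpace.Pack Au
  (UniformSpace.class Au_NormedModule_of_norm) Au.
Canonical Au_NormedModuleAux := NormedModuleAux.Pack C_AbsRing Au
  (NormedModuleAux.class C_AbsRing Au_NormedModule_of_norm) Au.
Canonical Au_NormedModule := NormedModule.Pack C_AbsRing Au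
  (NormedModule.class C_AbsRing Au_NormedModule_of_norm) Au.

Lemma restrict_holo (xi : dual V) : holomorphic (fun x => xi x).
Proof.
apply holomorphic_of with (fun x => xi x); [reflexivity|].
intros x; exists (fun y => xi y).
apply filterdiff_linear, dual_linear.
Qed.

Lemma restrict_unif (xi : dual V) : uniformly_continuous (fun x => xi x).
Proof.
destruct (dual_bound xi) as [M [HM Hxi]].
intros eps.
assert (He : 0 < eps / M) by (apply Rdiv_lt_0_compat; [apply cond_pos|exact HM]).
exists (mkposreal _ He); simpl; intros x y Hxy.
replace (xi y - xi x)%C with (xi (minus (ball_pt y) (ball_pt x))).
- eapply Rle_lt_trans; [apply Hxi|].
  replace (pos eps) with (M * (eps / M)) by (field; lra).
  apply Rmult_lt_compat_l; assumption.
- pose proof (dual_add xi (minus (ball_pt y) (ball_pt x)) x) as E.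
  apply (eq_trans (f_equal xi (eq_sym (plus_minus_cancel _ _)))) in E.
  rewrite E; ring.
Qed.

Definition restrict (xi : dual V) : Au :=
  MkAu _ (restrict_holo xi) (restrict_unif xi).

Record spectrum : Type := Spectrum {
  spectrum_fun :> Au -> C;
  spectrum_plus : forall f g : Au,
    spectrum_fun (plus f g) = (spectrum_fun f + spectrum_fun g)%C;
  spectrum_scal : forall (a : C) (f : Au),
    spectrum_fun (scal (a : C_AbsRing) f) = (a * spectrum_fun f)%C;
  spectrum_mult : forall f g : Au,
    spectrum_fun (mult f g) = (spectrum_fun f * spectrum_fun g)%C;
  spectrum_nonzero : exists f : Au, spectrum_fun f <> 0%C }.

Definition fiber (z : dual (dual_NormedModule V)) (phi : spectrum) : Prop :=
  forall xi : dual V, phi (restrict xi) = z xi.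

Definition spectrum_dist (phi psi : spectrum) : Rbar :=
  Lub_Rbar (fun r => exists f : Au, norm f <= 1 /\ r = Cmod (phi f - psi f)%C).

Definition gleason_part (phi psi : spectrum) : Prop :=
  Rbar_lt (spectrum_dist phi psi) 2.

End UniformAlgebra.

Arguments fiber {V} z phi.
Arguments spectrum_dist {V} phi psi.
Arguments gleason_part {V} phi psi.

Definition unit_sphere {V : NormedModule C_AbsRing} (x : V) : Prop := norm x = 1.

Definition closed_unit_ball {V : NormedModule C_AbsRing} (x : V) : Prop :=
  norm x <= 1.

Definition complex_extreme {V : NormedModule C_AbsRing} (K : V -> Prop) (z : V) :
    Prop :=
  K z /\
  forall y : V,
    (forall lambda : C, Cmod lambda <= 1 ->
       K (plus z (scal (lambda : C_AbsRing) y))) ->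
    y = zero.

Notation l1_bidual :=
  (dual_NormedModule (dual_NormedModule l1_NormedModule)).

(* Main.v *)
Require Import Defs.
From Stdlib Require Import Reals Lra Lia Arith Classical.
From Coquelicot Require Import Coquelicot.

(** Why every point of the sphere of the bidual of l_1 is a complex extreme point.
    A functional on l_1 is a bounded sequence, namely its values on the basis
    vectors, and its norm is the supremum of the moduli
    ([l1_dual_bound_of_basis]).  Suppose that z has norm 1 and that z + l y stays
    in the ball for all |l| <= 1.  Choose a functional xi of norm at most 1 with
    Re z(xi) >= 1 - eps.  If p is a direction along which the ball is flat to
    first order at xi, that is, |xi + s p| and |xi - s p| are at most 1 + s^2,
    then testing z + l y on xi + s p and z - l y on xi - s p and adding the two
    inequalities cancels the terms y(xi) and z(p) and leaves
    2 Re z(xi) + 2 s |y(p)| <= 2 + 2 s^2, so that s |y(p)| is at most eps + s^2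
    ([disc_perturbation_bound]); with eps = s^2 this gives
    |y(p)| <= 2 s.  In l_1' there are enough flat directions: in each coordinate
    a direction orthogonal to the value of xi is flat, and multiplication by i
    turns the radial part of an arbitrary direction into an orthogonal one, so that every eta
    of the unit ball is p - i q with p and q flat at xi
    ([l1_dual_tangent_split]).  Hence |y(eta)| <= 4 s for all small s, and y = 0.

    Why Gleason parts do not leave the fiber over a complex extreme point.  Möbius
    transformations of the disc act on the unit ball of the algebra.  They turn
    the strict inequality |phi - psi| < 2 into a bound rho < 1 on the
    pseudohyperbolic distance of phi(f) and psi(f), uniform in the unit ball,
    which yields an estimate
      k |phi(f) - psi(f)| <= 1 - |phi(f)|
    with k > 0 ([gleason_part_schwarz_pick]).  Applied to linear functionals it
    says that z + l k (z - w) stays in the closed unit ball for all |l| <= 1,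
    where z and w are the points below phi and psi; complex extremality of z
    forces w = z. *)

(** * Real and complex inequalities *)

(** Transfers an estimate from r f, whose values stay off the unit circle, to f. *)
Lemma le_of_forall_contraction (X M : R) :
  (forall r, 0 <= r < 1 -> r * X <= M) -> X <= M.
Proof.
intros H.
assert (HM : 0 <= M) by (pose proof (H 0); lra).
destruct (Rle_lt_dec X M) as [?|HX]; [assumption|exfalso].
assert (Hr : 0 <= (M + X) / (2 * X) < 1).
{ split; [apply Rdiv_le_0_compat; lra|].
  apply (Rdiv_lt_1 (M + X) (2 * X)); lra. }
pose proof (H _ Hr) as E.
replace ((M + X) / (2 * X) * X) with ((M + X) / 2) in E by (field; lra); lra.
Qed.

Lemma Cmod_le_of_sqr (a : C) (M : R) :
  0 <= M -> Re a ^ 2 + Im a ^ 2 <= M ^ 2 -> Cmod a <= M.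
Proof.
intros HM H.
apply Rsqr_incr_0_var; [|exact HM].
rewrite !Rsqr_pow2, Cmod2_alt; exact H.
Qed.

Lemma exists_rotation (b : C) :
  exists l : C, Cmod l = 1 /\ (l * b)%C = RtoC (Cmod b).
Proof.
destruct (Ceq_dec b 0) as [->|Hb].
- exists 1%C; rewrite Cmod_1, Cmod_0; split; [reflexivity|ring].
- pose proof (proj1 (Cmod_gt_0 b) Hb) as Hb'.
  assert (E0 : RtoC (Cmod b) <> 0%C) by (intros E; injection E; lra).
  exists (Cconj b / RtoC (Cmod b))%C; split.
  + rewrite Cmod_div, Cmod_conj, Cmod_R, Rabs_pos_eq by (assumption || lra).
    field; lra.
  + replace (Cconj b / RtoC (Cmod b) * b)%C
      with (b * Cconj b / RtoC (Cmod b))%C by (field; exact E0).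
    rewrite <- Cmod2_conj, RtoC_pow.
    simpl; field; exact E0.
Qed.

Lemma Cmod_sub_ge (a b : C) : Cmod a - Cmod b <= Cmod (a - b)%C.
Proof.
pose proof (Cmod_triangle (a - b) b)%C as Ht.
replace (a - b + b)%C with a in Ht by ring; lra.
Qed.

(** The difference of the squares of the two sides is
    (1 - |a|^2) (1 - |b|^2). *)
Lemma Cmod_mobius (a b : C) : Cmod a <= 1 -> Cmod b <= 1 ->
  Cmod (b - a)%C <= Cmod (1 - Cconj a * b)%C.
Proof.
intros Ha Hb.
pose proof (Cmod_ge_0 a); pose proof (Cmod_ge_0 b).
apply Cmod_le_of_sqr; [apply Cmod_ge_0|].
rewrite Cmod2_alt.
assert (Ha' : Cmod a ^ 2 <= 1) by (simpl; nra).
assert (Hb' : Cmod b ^ 2 <= 1) by (simpl; nra).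
rewrite Cmod2_alt in Ha', Hb'.
destruct a as [a1 a2], b as [b1 b2]; simpl in *.
assert (0 <= (1 - (a1 * a1 + a2 * a2)) * (1 - (b1 * b1 + b2 * b2)))
  by (apply Rmult_le_pos; lra).
lra.
Qed.

(** * Characters and Möbius transformations *)

(** Complex differentiability of the inverse: the remainder
    1/y - 1/z + (y - z)/z^2 is exactly (y - z)^2 / (z^2 y), and |y| >= |z|/2 near z. *)
Lemma filterdiff_Cinv (z : C) : z <> 0%C ->
  filterdiff (K := C_AbsRing) (U := C_NormedModule) (V := C_NormedModule)
    Cinv (locally z) (fun h : C => h * - / (z * z))%C.
Proof.
intros Hz.
pose proof (proj1 (Cmod_gt_0 z) Hz) as Hz'.
split.
(* The two normed module structures of C over itself have the same operations and
   norm, hence the same linear maps. *)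
- destruct (is_linear_scal_l (K := C_AbsRing) (V := AbsRing_NormedModule C_AbsRing)
      (- / (z * z))%C) as [H1 H2 H3]; split; assumption.
- intros x Hx.
  apply (is_filter_lim_locally_unique (K := C_AbsRing) (V := C_NormedModule)) in Hx.
  subst x; intros eps.
  apply (locally_le_locally_norm (K := C_AbsRing) (V := C_NormedModule)).
  pose proof (cond_pos eps) as He.
  assert (Hd : 0 < Rmin (Cmod z / 2) (eps * Cmod z ^ 3 / 2)).
  { apply Rmin_pos; [lra|].
    pose proof (pow_lt _ 3 Hz'); pose proof (Rmult_lt_0_compat _ _ He H); lra. }
  exists (mkposreal _ Hd).
  change (forall y : C, Cmod (y - z)%C < Rmin (Cmod z / 2) (eps * Cmod z ^ 3 / 2) ->
    Cmod (/ y - / z - (y - z) * - / (z * z))%C <= eps * Cmod (y - z)%C).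
  intros y Hy.
  pose proof (Rlt_le_trans _ _ _ Hy (Rmin_l _ _)) as H1.
  pose proof (Rlt_le_trans _ _ _ Hy (Rmin_r _ _)) as H2.
  assert (H3 : Cmod z / 2 <= Cmod y).
  { pose proof (Cmod_triangle (z - y) y)%C as Ht.
    replace (z - y + y)%C with z in Ht by ring.
    replace (z - y)%C with (- (y - z))%C in Ht by ring.
    rewrite Cmod_opp in Ht; lra. }
  assert (Hy0 : y <> 0%C) by (apply Cmod_gt_0; lra).
  replace (/ y - / z - (y - z) * - / (z * z))%C
    with ((y - z) * ((y - z) / (z * z * y)))%C
    by (field; split; assumption).
  rewrite Cmod_mult, Rmult_comm.
  apply Rmult_le_compat_r; [apply Cmod_ge_0|].
  assert (Hzy : (z * z * y)%C <> 0%C) by (repeat apply Cmult_neq_0; assumption).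
  rewrite Cmod_div, !Cmod_mult by exact Hzy.
  assert (0 < Cmod z * Cmod z * Cmod y)
    by (repeat apply Rmult_lt_0_compat; lra).
  apply Rle_div_l; [assumption|].
  apply Rle_trans with (eps * Cmod z ^ 3 / 2); [lra|].
  replace (eps * Cmod z ^ 3 / 2) with (eps * (Cmod z * Cmod z * (Cmod z / 2)))
    by field.
  apply Rmult_le_compat_l; [lra|].
  apply Rmult_le_compat_l; [nra|exact H3].
Qed.

Section Characters.

Context {V : NormedModule C_AbsRing}.

(** The lower bound makes 1/g uniformly continuous, so the algebra is inverse
    closed. *)
Lemma Au_inverse (g : Au V) (delta : R) :
  0 < delta -> (forall x, delta <= Cmod (g x)) ->
  exists h : Au V, Au_mult V g h = Au_one V.
Proof.
intros Hd Hg.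
assert (Hg0 : forall x, g x <> 0%C).
{ intros x; apply Cmod_gt_0; pose proof (Hg x); lra. }
assert (Hh : holomorphic V (fun x => / g x)%C).
{ apply holomorphic_of with (fun x => / extend V g x)%C.
  - intros x; rewrite extend_in; reflexivity.
  - intros x.
    destruct (Au_holomorphic V g x) as [l Hl].
    eexists.
    apply (filterdiff_comp' (K := C_AbsRing) (V := C_NormedModule)
             (W := C_NormedModule) (extend V g) Cinv _ l
             (fun h : C => h * - / (extend V g x * extend V g x))%C Hl).
    apply filterdiff_Cinv; rewrite extend_in; apply Hg0. }
assert (Hu : uniformly_continuous V (fun x => / g x)%C).
{ intros eps.
  assert (He : 0 < eps * (delta * delta))
    by (repeat apply Rmult_lt_0_compat; [apply cond_pos| |]; lra).
  destruct (Au_uniformly_continuous V g (mkposreal _ He)) as [d Hd'].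
  exists d; intros x y Hxy; specialize (Hd' x y Hxy); simpl in Hd'.
  pose proof (Hg x) as Hx; pose proof (Hg y) as Hy.
  replace (/ g y - / g x)%C with (- (g y - g x) / (g x * g y))%C
    by (field; split; apply Hg0).
  rewrite Cmod_div, Cmod_opp, Cmod_mult by (apply Cmult_neq_0; apply Hg0).
  apply Rlt_div_l; [apply Rmult_lt_0_compat; lra|].
  eapply Rlt_le_trans; [exact Hd'|].
  apply Rmult_le_compat_l; [apply Rlt_le, cond_pos|].
  apply Rmult_le_compat; lra. }
exists (MkAu V _ Hh Hu).
apply Au_ext; intros x; simpl; field; apply Hg0.
Qed.

Implicit Types chi phi psi : spectrum V.

Lemma spectrum_one chi : chi (Au_one V) = 1%C.
Proof.
destruct (spectrum_nonzero V chi) as [f Hf].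
pose proof (spectrum_mult V chi f (Au_one V)) as E.
change (chi (Au_mult V f (Au_one V)) = (chi f * chi (Au_one V))%C) in E.
rewrite Au_mult_one_r in E.
replace (chi (Au_one V)) with (/ chi f * (chi f * chi (Au_one V)))%C
  by (field; exact Hf).
rewrite <- E; field; exact Hf.
Qed.

Lemma spectrum_add chi (f g : Au V) : chi (Au_plus V f g) = (chi f + chi g)%C.
Proof. exact (spectrum_plus V chi f g). Qed.

Lemma spectrum_mul chi (f g : Au V) : chi (Au_mult V f g) = (chi f * chi g)%C.
Proof. exact (spectrum_mult V chi f g). Qed.

Lemma spectrum_scal_mul chi (a : C) (f : Au V) :
  chi (Au_scal V a f) = (a * chi f)%C.
Proof. exact (spectrum_scal V chi a f). Qed.

Lemma spectrum_const chi (c : C) : chi (Au_const V c) = c.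
Proof.
rewrite <- (Au_mult_one_r V (Au_const V c)).
change (chi (Au_scal V c (Au_one V)) = c).
rewrite spectrum_scal_mul, spectrum_one; ring.
Qed.

(** If |chi(f)| exceeded M, then f - chi(f) would be bounded away from 0, hence
    invertible, although chi annihilates it. *)
Lemma spectrum_contractive chi (f : Au V) (M : R) :
  (forall x, Cmod (f x) <= M) -> Cmod (chi f) <= M.
Proof.
intros Hf.
destruct (Rle_lt_dec (Cmod (chi f)) M) as [?|HM]; [assumption|exfalso].
set (g := Au_plus V f (Au_const V (- chi f)%C)).
destruct (Au_inverse g (Cmod (chi f) - M)) as [h Hh]; [lra| |].
- intros x; simpl.
  pose proof (Cmod_triangle (f x) (- (f x + - chi f)))%C as Ht.
  replace (f x + - (f x + - chi f))%C with (chi f) in Ht by ring.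
  rewrite Cmod_opp in Ht; pose proof (Hf x); lra.
- apply (f_equal chi) in Hh.
  unfold g in Hh.
  rewrite spectrum_mul, spectrum_add, spectrum_const, spectrum_one in Hh.
  replace ((chi f + - chi f) * chi h)%C with (RtoC 0) in Hh by ring.
  injection Hh; lra.
Qed.

(** The Möbius transformation (f - a) / (1 - conj(a) f) is formed inside the
    algebra, so that every character commutes with it by multiplicativity. *)
Lemma Au_mobius (f : Au V) (a : C) :
  (forall x, Cmod (f x) <= 1) -> Cmod a < 1 ->
  exists g : Au V, (forall x, Cmod (g x) <= 1) /\
    forall chi, chi g = ((chi f - a) / (1 - Cconj a * chi f))%C.
Proof.
intros Hf Ha.
set (D := Au_plus V (Au_one V) (Au_scal V (- Cconj a)%C f)).
assert (HD : forall b : C, Cmod b <= 1 -> 1 - Cmod a <= Cmod (1 - Cconj a * b)%C).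
{ intros b Hb; pose proof (Cmod_sub_ge 1 (Cconj a * b)) as H.
  rewrite Cmod_1, Cmod_mult, Cmod_conj in H.
  pose proof (Cmod_ge_0 a); nra. }
assert (ED : forall x, D x = (1 - Cconj a * f x)%C).
{ intros x; simpl; ring. }
destruct (Au_inverse D (1 - Cmod a)) as [h Hh]; [lra| |].
{ intros x; rewrite ED; apply HD, Hf. }
assert (Eh : forall x, h x = (/ (1 - Cconj a * f x))%C).
{ intros x.
  assert (H0 : (1 - Cconj a * f x)%C <> 0%C).
  { apply Cmod_gt_0; pose proof (HD _ (Hf x)); lra. }
  apply (f_equal (fun k : Au V => k x)) in Hh.
  change ((D x * h x)%C = 1%C) in Hh; rewrite ED in Hh.
  replace (h x) with (/ (1 - Cconj a * f x) * ((1 - Cconj a * f x) * h x))%C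
    by (field; exact H0).
  rewrite Hh; ring. }
exists (Au_mult V (Au_plus V f (Au_const V (- a)%C)) h); split.
- intros x; simpl; rewrite Eh.
  pose proof (HD _ (Hf x)) as H1.
  rewrite Cmod_mult, Cmod_inv by (apply Cmod_gt_0; lra).
  apply Rle_div_l; [lra|].
  rewrite Rmult_1_l; apply (Cmod_mobius a (f x)); [lra|apply Hf].
- intros chi.
  pose proof (HD _ (spectrum_contractive chi f 1 Hf)) as H1.
  assert (H0 : (1 - Cconj a * chi f)%C <> 0%C) by (apply Cmod_gt_0; lra).
  apply (f_equal chi) in Hh; unfold D in Hh.
  rewrite spectrum_mul, spectrum_add, spectrum_scal_mul, spectrum_one in Hh.
  rewrite spectrum_mul, spectrum_add, spectrum_const.
  replace (chi h) with (/ (1 - Cconj a * chi f)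
    * ((1 + - Cconj a * chi f) * chi h))%C by (field; exact H0).
  rewrite Hh; field; exact H0.
Qed.

Lemma gleason_part_lt2 phi psi : gleason_part phi psi ->
  exists d, 0 <= d < 2 /\ forall f : Au V, (forall x, Cmod (f x) <= 1) ->
    Cmod (phi f - psi f)%C <= d.
Proof.
unfold gleason_part, spectrum_dist; intros H.
set (E := fun r => _) in H.
destruct (Lub_Rbar_correct E) as [Hub _].
assert (HE : forall f : Au V, (forall x, Cmod (f x) <= 1) ->
               E (Cmod (phi f - psi f)%C)).
{ intros f Hf; exists f; split; [|reflexivity].
  apply (sup_mod_le _ (unit_ball_zero V) I); intros x _; apply Hf. }
assert (H0 : E (Cmod (phi (Au_zero V) - psi (Au_zero V))%C)).
{ apply HE; intros x; simpl; rewrite Cmod_0; lra. }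
pose proof (Hub _ H0) as Hz.
destruct (Lub_Rbar E) as [d| |]; simpl in H, Hz; try contradiction.
exists d; split.
- pose proof (Cmod_ge_0 (phi (Au_zero V) - psi (Au_zero V))%C); lra.
- intros f Hf; exact (Hub _ (HE f Hf)).
Qed.

(** Let d < 2 bound |phi - psi| and t = |psi(g)|.  After a rotation, a Möbius map
    with parameter s takes the values 0 and t to points at distance
    t (1 - s^2) / (1 - s t) <= d.  For s = d/2 this is linear in t and reads
    t <= d / (1 + d^2/4), which is below 1 because (1 - d/2)^2 > 0. *)
Lemma gleason_part_pseudohyperbolic phi psi : gleason_part phi psi ->
  exists rho, 0 <= rho < 1 /\ forall g : Au V, (forall x, Cmod (g x) <= 1) ->
    phi g = 0%C -> Cmod (psi g) <= rho.
Proof.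
intros H; destruct (gleason_part_lt2 _ _ H) as [d [Hd Hdist]].
assert (Hp : 0 < 1 + d * d / 4) by nra.
exists (d / (1 + d * d / 4)); split.
{ split; [apply Rdiv_le_0_compat; lra|].
  apply Rlt_div_l; nra. }
intros g Hg Eg.
apply Rle_div_r; [exact Hp|].
destruct (exists_rotation (psi g)) as [l [Hl El]].
set (s := d / 2).
(* The parameter s conj(l) has the argument of psi(g). *)
assert (Ea : Cmod (RtoC s * Cconj l)%C = s).
{ rewrite Cmod_mult, Cmod_conj, Hl, Cmod_R, Rabs_pos_eq by (unfold s; lra); ring. }
destruct (Au_mobius g (RtoC s * Cconj l)%C Hg) as [m [Hm Em]].
{ rewrite Ea; unfold s; lra. }
pose proof (Hdist m Hm) as H1; rewrite !Em, Eg in H1.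
pose proof (spectrum_contractive psi g 1 Hg) as Ht.
set (t := Cmod (psi g)) in *.
assert (Ht0 : 0 <= t) by apply Cmod_ge_0.
assert (Hst : 0 < 1 - s * t) by (unfold s; nra).
assert (Ell : (l * Cconj l)%C = 1%C).
{ rewrite <- Cmod2_conj, Hl; f_equal; ring. }
assert (Eb : (Cconj (RtoC s * Cconj l) * psi g)%C = RtoC (s * t)).
{ assert (Es : Cconj (RtoC s) = RtoC s).
  { unfold Cconj, RtoC; simpl; rewrite Ropp_0; reflexivity. }
  rewrite Cmult_conj, Cconj_conj, Es, <- Cmult_assoc, El, RtoC_mult.
  reflexivity. }
assert (Epsi : psi g = (Cconj l * RtoC t)%C).
{ rewrite <- El, Cmult_assoc, (Cmult_comm (Cconj l)), Ell; ring. }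
assert (H0 : RtoC (1 - s * t) <> 0%C) by (intros E; injection E; lra).
replace ((0 - RtoC s * Cconj l) / (1 - Cconj (RtoC s * Cconj l) * 0)
         - (psi g - RtoC s * Cconj l) / (1 - Cconj (RtoC s * Cconj l) * psi g))%C
  with (- (Cconj l * (RtoC (t * (1 - s * s)) / RtoC (1 - s * t))))%C in H1.
2:{ rewrite Eb, Epsi, Cmult_0_r.
    rewrite RtoC_minus, RtoC_mult in H0.
    rewrite !RtoC_mult, !RtoC_minus, !RtoC_mult.
    field; exact H0. }
rewrite Cmod_opp, Cmod_mult, Cmod_conj, Hl, Cmod_div, !Cmod_R in H1 by exact H0.
assert (Hs1 : 0 <= t * (1 - s * s))
  by (apply Rmult_le_pos; [exact Ht0|unfold s; nra]).
rewrite Rmult_1_l, !Rabs_pos_eq in H1 by lra.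
apply Rle_div_l in H1; [|exact Hst].
unfold s in H1; nra.
Qed.

(** Moving a = phi(f) to 0 bounds the pseudohyperbolic distance of a and
    b = psi(f) by rho, that is |a - b| <= rho |1 - conj(a) b|.  Since
    1 - conj(a) b = 1 - |a|^2 + conj(a) (a - b), this gives
    (1 - rho) |a - b| <= 1 - |a|^2 <= 2 (1 - |a|).  The case |a| = 1, where the
    Möbius map degenerates, follows by applying this to r f with r < 1. *)
Lemma gleason_part_schwarz_pick phi psi : gleason_part phi psi ->
  exists k, 0 < k /\ forall f : Au V, (forall x, Cmod (f x) <= 1) ->
    k * Cmod (phi f - psi f)%C <= 1 - Cmod (phi f).
Proof.
intros H; destruct (gleason_part_pseudohyperbolic _ _ H) as [rho [Hrho Hpsi]].
exists ((1 - rho) / 2); split; [lra|].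
assert (Hlt : forall f : Au V, (forall x, Cmod (f x) <= 1) -> Cmod (phi f) < 1 ->
    (1 - rho) / 2 * Cmod (phi f - psi f)%C <= 1 - Cmod (phi f)).
{ intros f Hf Ha.
  destruct (Au_mobius f (phi f) Hf Ha) as [g [Hg Eg]].
  pose proof (spectrum_contractive psi f 1 Hf) as Hb.
  set (a := phi f) in *; set (b := psi f) in *.
  assert (E0 : phi g = 0%C).
  { rewrite Eg; unfold Cdiv, Cminus; fold a; rewrite Cplus_opp_r; ring. }
  pose proof (Hpsi g Hg E0) as H1; rewrite Eg in H1; fold b in H1.
  pose proof (Cmod_ge_0 a) as Ha0.
  assert (Ha2 : 0 <= 1 - Cmod a ^ 2) by (simpl; nra).
  assert (HD : 0 < Cmod (1 - Cconj a * b)%C).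
  { pose proof (Cmod_sub_ge 1 (Cconj a * b)) as H2.
    rewrite Cmod_1, Cmod_mult, Cmod_conj in H2; nra. }
  rewrite Cmod_div in H1 by (apply Cmod_gt_0; exact HD).
  apply Rle_div_l in H1; [|exact HD].
  assert (H3 : Cmod (1 - Cconj a * b)%C
               <= 1 - Cmod a ^ 2 + Cmod a * Cmod (a - b)%C).
  { replace (1 - Cconj a * b)%C
      with (RtoC (1 - Cmod a ^ 2) + Cconj a * (a - b))%C.
    - eapply Rle_trans; [apply Cmod_triangle|].
      rewrite Cmod_R, Cmod_mult, Cmod_conj, Rabs_pos_eq by exact Ha2; lra.
    - rewrite RtoC_minus, Cmod2_conj; ring. }
  replace (b - a)%C with (- (a - b))%C in H1 by ring.
  rewrite Cmod_opp in H1.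
  pose proof (Cmod_ge_0 (a - b)%C) as Hab.
  set (D := Cmod (a - b)%C) in *.
  assert (rho * Cmod (1 - Cconj a * b)%C <= rho * (1 - Cmod a ^ 2 + Cmod a * D))
    by (apply Rmult_le_compat_l; lra).
  assert (rho * (Cmod a * D) <= rho * D)
    by (apply Rmult_le_compat_l; nra).
  assert (rho * (1 - Cmod a ^ 2) <= 1 - Cmod a ^ 2) by nra.
  nra. }
intros f Hf.
enough ((1 - rho) / 2 * Cmod (phi f - psi f)%C + Cmod (phi f) <= 1) by lra.
apply le_of_forall_contraction; intros r Hr.
pose proof (spectrum_contractive phi f 1 Hf) as Ha.
pose proof (Hlt (Au_scal V (RtoC r) f)) as H1.
rewrite !spectrum_scal_mul in H1.
replace (RtoC r * phi f - RtoC r * psi f)%C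
  with (RtoC r * (phi f - psi f))%C in H1 by ring.
rewrite !Cmod_mult, Cmod_R, Rabs_pos_eq in H1 by lra.
enough ((1 - rho) / 2 * (r * Cmod (phi f - psi f)%C) <= 1 - r * Cmod (phi f)) by lra.
pose proof (Cmod_ge_0 (phi f)).
apply H1; [|nra].
intros x; simpl; rewrite Cmod_mult, Cmod_R, Rabs_pos_eq by lra.
pose proof (Hf x); pose proof (Cmod_ge_0 (f x)); nra.
Qed.

End Characters.

(** * The norm of a dual space *)

Section DualNorm.

Context {V : NormedModule C_AbsRing}.

Lemma dual_norm_of_bound (f : dual V) (M : R) :
  (forall x, norm x <= 1 -> Cmod (f x) <= M) -> dual_norm V f <= M.
Proof. exact (sup_mod_le _ zero (norm_zero_le1 V) f M). Qed.

Lemma dual_le_norm (f : dual V) (x : V) :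
  norm x <= 1 -> Cmod (f x) <= dual_norm V f.
Proof. exact (sup_mod_ub _ zero (norm_zero_le1 V) f x (dual_bounded V f)). Qed.

Lemma dual_le_norm_mul (f : dual V) (x : V) :
  Cmod (f x) <= dual_norm V f * norm x.
Proof.
pose proof (norm_ge_0 x) as Hx.
destruct (Req_dec (norm x) 0) as [H0|H0].
- rewrite (norm_eq_zero x H0).
  destruct (dual_bound f) as [M [_ HM]].
  eapply Rle_trans; [apply HM|].
  rewrite norm_zero, !Rmult_0_r; apply Rle_refl.
- assert (Ht : 0 < / norm x) by (apply Rinv_0_lt_compat; lra).
  pose proof (dual_le_norm f (scal (RtoC (/ norm x) : C_AbsRing) x)) as H.
  pose proof (norm_scal (RtoC (/ norm x) : C_AbsRing) x) as Hs.
  change (norm (scal (RtoC (/ norm x) : C_AbsRing) x)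
          <= Cmod (RtoC (/ norm x)) * norm x) in Hs.
  rewrite dual_mul, Cmod_mult in H.
  rewrite Cmod_R, Rabs_pos_eq in H, Hs by lra.
  rewrite Rinv_l in Hs by exact H0.
  specialize (H Hs).
  apply Rmult_le_reg_l with (/ norm x); [exact Ht|].
  eapply Rle_trans; [exact H|].
  right; field; exact H0.
Qed.

(** Rotating a vector at which |z| is almost attained makes the value real and
    positive. *)
Lemma dual_almost_norming (z : dual V) (eps : R) : 0 < eps ->
  exists x : V, norm x <= 1 /\ dual_norm V z - eps <= Re (z x).
Proof.
intros He.
assert (H : exists x : V, norm x <= 1 /\ dual_norm V z - eps < Cmod (z x)).
{ apply NNPP; intros Hn.
  assert (dual_norm V z <= dual_norm V z - eps); [|lra].
  apply dual_norm_of_bound; intros x Hx.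
  apply Rnot_lt_le; intros Hlt; apply Hn; exists x; auto. }
destruct H as [x [Hx Hzx]].
destruct (exists_rotation (z x)) as [l [Hl El]].
exists (scal (l : C_AbsRing) x); split.
- eapply Rle_trans; [apply norm_scal|].
  change (Cmod l * norm x <= 1); rewrite Hl; lra.
- rewrite dual_mul, El; simpl; lra.
Qed.

(** The values of z + l y at x + s p and of z - l y at x - s p have modulus at
    most 1 + s^2.  In the sum of their real parts the terms l y(x) and s z(p)
    cancel and s l y(p) appears twice; l rotates y(p) onto the positive axis. *)
Lemma disc_perturbation_bound (z y : dual V) (x p : V) (eps s : R) :
  (forall l : C, Cmod l <= 1 ->
     dual_norm V (dual_plus V z (dual_scal V l y)) <= 1) ->
  1 - eps <= Re (z x) -> 0 <= s ->
  norm (plus x (scal (RtoC s : C_AbsRing) p)) <= 1 + s ^ 2 ->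
  norm (plus x (scal (RtoC (- s) : C_AbsRing) p)) <= 1 + s ^ 2 ->
  s * Cmod (y p) <= eps + s ^ 2.
Proof.
intros Hdisc Hx Hs Hplus Hminus.
destruct (exists_rotation (y p)) as [l [Hl El]].
assert (H : forall (k : C) (t : R), Cmod k <= 1 ->
  norm (plus x (scal (RtoC t : C_AbsRing) p)) <= 1 + s ^ 2 ->
  Re (z x) + t * Re (z p) + Re (k * y x)%C + t * Re (k * y p)%C <= 1 + s ^ 2).
{ intros k t Hk Ht.
  pose proof (dual_le_norm_mul (dual_plus V z (dual_scal V k y))
                (plus x (scal (RtoC t : C_AbsRing) p))) as H1.
  pose proof (Hdisc k Hk) as H2.
  pose proof (dual_norm_ge0 V (dual_plus V z (dual_scal V k y))) as H3.
  pose proof (norm_ge_0 (plus x (scal (RtoC t : C_AbsRing) p))) as H4.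
  assert (H5 : Cmod (z (plus x (scal (RtoC t : C_AbsRing) p))
    + k * y (plus x (scal (RtoC t : C_AbsRing) p)))%C <= 1 + s ^ 2).
  { eapply Rle_trans; [exact H1|nra]. }
  rewrite !dual_add, !dual_mul in H5.
  eapply Rle_trans; [|exact H5].
  eapply Rle_trans; [|apply re_le_Cmod].
  eapply Rle_trans; [|apply Rle_abs].
  right; destruct k, (z x), (z p), (y x), (y p); simpl; ring. }
pose proof (H l s) as H1; pose proof (H (- l)%C (- s)) as H2.
rewrite Cmod_opp in H2.
specialize (H1 (Req_le _ _ Hl) Hplus); specialize (H2 (Req_le _ _ Hl) Hminus).
replace (- l * y x)%C with (- (l * y x))%C in H2 by ring.
replace (- l * y p)%C with (- (l * y p))%C in H2 by ring.
change (Re (- (l * y x))%C) with (- Re (l * y x)%C) in H2.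
change (Re (- (l * y p))%C) with (- Re (l * y p)%C) in H2.
rewrite El in H1, H2; change (Re (RtoC (Cmod (y p)))) with (Cmod (y p)) in H1, H2.
lra.
Qed.

End DualNorm.

Section Evaluation.

Context {V : NormedModule C_AbsRing}.

Lemma evaluation_linear (x : V) :
  is_linear (fun f : dual_NormedModule V => (f : dual V) x).
Proof.
split.
- reflexivity.
- reflexivity.
- exists (norm x + 1); split; [pose proof (norm_ge_0 x); lra|].
  intros f; change (Cmod ((f : dual V) x) <= (norm x + 1) * dual_norm V f).
  pose proof (dual_le_norm_mul f x); pose proof (dual_norm_ge0 V f); nra.
Qed.

Definition evaluation (x : V) : dual (dual_NormedModule V) :=
  Dual _ _ (evaluation_linear x).

Lemma evaluation_norm_le1 (x : V) :
  norm x <= 1 -> dual_norm _ (evaluation x) <= 1.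
Proof.
intros Hx; apply dual_norm_of_bound; intros f Hf.
change (Cmod ((f : dual V) x) <= 1).
eapply Rle_trans; [apply dual_le_norm, Hx|exact Hf].
Qed.

End Evaluation.

(** * Gleason parts over complex extreme points *)

(** By the Schwarz-Pick estimate, y = k (z - w) satisfies
    |z(xi)| + |y(xi)| <= 1 for every xi of the unit ball, so the disc of centre z
    and direction y lies in the closed unit ball. *)
Theorem gleason_part_complex_extreme_fiber
    {V : NormedModule C_AbsRing} (z w : dual (dual_NormedModule V)) (phi psi : spectrum V) :
  complex_extreme (V := dual_NormedModule (dual_NormedModule V))
    closed_unit_ball z ->
  fiber z phi -> fiber w psi -> gleason_part phi psi -> w = z.
Proof.
intros [_ Hext] Hz Hw H.
destruct (gleason_part_schwarz_pick _ _ H) as [k [Hk Hsp]].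
set (y := dual_scal (dual_NormedModule V) (RtoC k)
            (dual_plus _ z (dual_opp _ w))).
assert (Hy : y = dual_zero _).
{ apply Hext; intros l Hl.
  apply dual_norm_of_bound; intros xi Hxi.
  assert (Hf : forall x, Cmod (restrict V xi x) <= 1).
  { intros x; eapply Rle_trans; [|exact Hxi].
    apply dual_le_norm, Rlt_le, (proj2_sig x). }
  pose proof (Hsp _ Hf) as H1; rewrite Hz, Hw in H1.
  change (Cmod (z xi + l * (RtoC k * (z xi + (-1) * w xi)))%C <= 1).
  eapply Rle_trans; [apply Cmod_triangle|].
  replace (z xi + (-1) * w xi)%C with (z xi - w xi)%C by ring.
  rewrite !Cmod_mult, Cmod_R, Rabs_pos_eq by lra.
  pose proof (Cmod_ge_0 (z xi - w xi)%C).
  assert (0 <= k * Cmod (z xi - w xi)%C) by nra.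
  nra. }
apply dual_ext; intros xi.
apply (f_equal (fun u : dual (dual_NormedModule V) => u xi)) in Hy.
change ((RtoC k * (z xi + (-1) * w xi))%C = 0%C) in Hy.
assert (Hk0 : RtoC k <> 0%C) by (intros E; injection E; lra).
replace (w xi) with (z xi - / RtoC k * (RtoC k * (z xi + (-1) * w xi)))%C
  by (field; exact Hk0).
rewrite Hy; ring.
Qed.

(** * Functionals on l_1 as bounded sequences *)

Lemma l1_mult_summable (m : nat -> C) (Hm : forall n, Cmod (m n) <= 1) (x : l1) :
  ex_series (fun n => Cmod (m n * x n)%C).
Proof.
apply (ex_series_le (K := R_AbsRing) (V := R_CompleteNormedModule)
         _ (fun n => Cmod (x n))); [|apply l1_summable].
intros n; change (Rabs (Cmod (m n * x n)%C) <= Cmod (x n)).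
rewrite Rabs_pos_eq, Cmod_mult by apply Cmod_ge_0.
pose proof (Hm n); pose proof (Cmod_ge_0 (x n)); nra.
Qed.

(** Composing a functional with this map multiplies the bounded sequence that
    represents it by m. *)
Definition l1_mult (m : nat -> C) (Hm : forall n, Cmod (m n) <= 1) (x : l1) : l1 :=
  L1 _ (l1_mult_summable m Hm x).

Lemma l1_norm_mult (m : nat -> C) (Hm : forall n, Cmod (m n) <= 1) (x : l1) :
  l1_norm (l1_mult m Hm x) <= l1_norm x.
Proof.
apply Series_le; [|apply l1_summable].
intros n; simpl; split; [apply Cmod_ge_0|].
rewrite Cmod_mult; pose proof (Hm n); pose proof (Cmod_ge_0 (x n)); nra.
Qed.

Lemma is_series_l1_basis (n : nat) :
  is_series (fun k => Cmod (if k =? n then 1 else 0)%C) 1.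
Proof.
change (is_lim_seq (sum_n (fun k => Cmod (if k =? n then 1 else 0)%C)) 1).
apply (is_lim_seq_ext_loc (fun _ => 1)); [|apply is_lim_seq_const].
exists n; intros m Hm; rewrite sum_n_Reals; symmetry.
assert (H : forall j, sum_f_R0 (fun k => Cmod (if k =? n then 1 else 0)%C) j
                      = if n <=? j then 1 else 0).
{ induction j as [|j IH]; cbn [sum_f_R0].
  - destruct n; simpl; [apply Cmod_1|apply Cmod_0].
  - rewrite IH; clear IH.
    destruct (Nat.eqb_spec (S j) n), (Nat.leb_spec n j), (Nat.leb_spec n (S j));
      try lia; rewrite ?Cmod_0, ?Cmod_1; ring. }
rewrite H; destruct (Nat.leb_spec n m); [reflexivity|lia].
Qed.

Definition l1_basis (n : nat) : l1 := L1 _ (ex_intro _ 1 (is_series_l1_basis n)).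

Lemma l1_norm_basis (n : nat) : l1_norm (l1_basis n) = 1.
Proof. apply is_series_unique, is_series_l1_basis. Qed.

Lemma Cmod_indicator_le1 (b : bool) : Cmod (if b then 1 else 0)%C <= 1.
Proof. destruct b; rewrite ?Cmod_0, ?Cmod_1; lra. Qed.

Definition l1_tail (n : nat) (x : l1) : l1 :=
  l1_mult (fun k => if n <=? k then 1 else 0)%C
    (fun k => Cmod_indicator_le1 (n <=? k)) x.

Lemma l1_tail_0 (x : l1) : l1_tail 0 x = x.
Proof. apply l1_ext; intros k; simpl; ring. Qed.

Lemma l1_tail_S (n : nat) (x : l1) :
  l1_tail n x = l1_plus (l1_scal (x n) (l1_basis n)) (l1_tail (S n) x).
Proof.
apply l1_ext; intros k; cbn -[Nat.leb].
destruct (Nat.eqb_spec k n), (Nat.leb_spec n k), (Nat.leb_spec (S n) k);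
  try lia; subst; ring.
Qed.

Lemma l1_norm_tail (n : nat) (x : l1) :
  l1_norm x = sum_f_R0 (fun k => Cmod (x k)) n + l1_norm (l1_tail (S n) x).
Proof.
unfold l1_norm at 1.
rewrite (Series_incr_n _ (S n)) by (try lia; apply l1_summable).
f_equal; unfold l1_norm.
rewrite (Series_incr_n (fun k => Cmod (l1_tail (S n) x k)) (S n))
  by (try lia; apply l1_summable).
rewrite sum_eq_R0.
- rewrite Rplus_0_l; apply Series_ext; intros k; cbn -[Nat.leb].
  destruct (Nat.leb_spec (S n) (S (n + k))); [|lia].
  f_equal; ring.
- intros k Hk; cbn -[Nat.leb].
  destruct (Nat.leb_spec (S n) k); [simpl in Hk; lia|].
  rewrite Cmult_0_l; apply Cmod_0.
Qed.

(** Splitting off the first coordinates one by one gives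
    |f(x)| <= K (|x_0| + ... + |x_n|) + |f(tail)|, and continuity of f makes the
    last term tend to 0. *)
Lemma l1_dual_bound_of_basis (f : dual l1_NormedModule) (K : R) :
  (forall n, Cmod (f (l1_basis n)) <= K) ->
  forall x : l1, Cmod (f x) <= K * l1_norm x.
Proof.
intros HK x.
destruct (dual_bound f) as [M [HM Hf]].
set (A := sum_f_R0 (fun k => Cmod (x k))).
assert (Hstep : forall n, Cmod (f (l1_tail n x))
                 <= K * Cmod (x n) + Cmod (f (l1_tail (S n) x))).
{ intros n; rewrite l1_tail_S at 1.
  pose proof (dual_add f (l1_scal (x n) (l1_basis n)) (l1_tail (S n) x)) as E.
  pose proof (dual_mul f (x n) (l1_basis n)) as E'.
  change (f (l1_scal (x n) (l1_basis n)) = (x n * f (l1_basis n))%C) in E'.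
  rewrite E' in E.
  apply (f_equal Cmod), Req_le in E.
  eapply Rle_trans; [exact E|].
  eapply Rle_trans; [apply Cmod_triangle|].
  rewrite Cmod_mult, (Rmult_comm K).
  pose proof (HK n); pose proof (Cmod_ge_0 (x n)); nra. }
assert (Hn : forall n, Cmod (f x) <= K * A n + M * (l1_norm x - A n)).
{ intros n.
  apply Rle_trans with (K * A n + Cmod (f (l1_tail (S n) x))).
  - induction n as [|n IH].
    + pose proof (Hstep 0%nat) as H; rewrite l1_tail_0 in H; exact H.
    + eapply Rle_trans; [exact IH|].
      pose proof (Hstep (S n)); unfold A in *; simpl sum_f_R0; lra.
  - apply Rplus_le_compat_l.
    eapply Rle_trans; [apply Hf|].
    change (M * l1_norm (l1_tail (S n) x) <= M * (l1_norm x - A n)).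
    rewrite (l1_norm_tail n x); fold (A n); right; ring. }
assert (HA : is_lim_seq A (l1_norm x)).
{ apply (is_lim_seq_ext (sum_n (fun k => Cmod (x k)))); [apply sum_n_Reals|].
  exact (Series_correct _ (l1_summable x)). }
apply (is_lim_seq_le (fun _ => Cmod (f x))
         (fun n => K * A n + M * (l1_norm x - A n))
         (Cmod (f x)) (K * l1_norm x)); [exact Hn|apply is_lim_seq_const|].
replace (K * l1_norm x) with (K * l1_norm x + M * (l1_norm x - l1_norm x)) by ring.
apply is_lim_seq_plus'.
- apply (is_lim_seq_scal_l A K (l1_norm x)); exact HA.
- apply (is_lim_seq_scal_l (fun n => l1_norm x - A n) M (l1_norm x - l1_norm x)).
  apply is_lim_seq_minus'; [apply is_lim_seq_const|exact HA].
Qed.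

Lemma l1_dual_norm_le (f : dual l1_NormedModule) (K : R) :
  0 <= K -> (forall n, Cmod (f (l1_basis n)) <= K) ->
  dual_norm l1_NormedModule f <= K.
Proof.
intros HK Hf; apply dual_norm_of_bound; intros x Hx.
eapply Rle_trans; [apply (l1_dual_bound_of_basis f K Hf)|].
change (l1_norm x <= 1) in Hx; nra.
Qed.

Lemma l1_dual_basis_le (f : dual l1_NormedModule) (n : nat) :
  Cmod (f (l1_basis n)) <= dual_norm l1_NormedModule f.
Proof.
apply (dual_le_norm f (l1_basis n)); right; apply l1_norm_basis.
Qed.

Lemma dual_mult_linear (f : dual l1_NormedModule) (m : nat -> C)
    (Hm : forall n, Cmod (m n) <= 1) :
  is_linear (fun x : l1_NormedModule => f (l1_mult m Hm x)).
Proof.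
split.
- intros x y.
  pose proof (dual_add f (l1_mult m Hm x) (l1_mult m Hm y)) as E.
  refine (eq_trans (f_equal f _) E).
  apply l1_ext; intros n; simpl; ring.
- intros a x.
  pose proof (dual_mul f a (l1_mult m Hm x)) as E.
  refine (eq_trans (f_equal f _) E).
  apply l1_ext; intros n; simpl; ring.
- destruct (dual_bound f) as [M [HM Hf]].
  exists M; split; [exact HM|intros x].
  eapply Rle_trans; [apply Hf|].
  apply Rmult_le_compat_l; [lra|apply l1_norm_mult].
Qed.

Definition dual_mult (f : dual l1_NormedModule) (m : nat -> C)
    (Hm : forall n, Cmod (m n) <= 1) : dual l1_NormedModule :=
  Dual _ _ (dual_mult_linear f m Hm).

Lemma dual_mult_basis (f : dual l1_NormedModule) (m : nat -> C)
    (Hm : forall n, Cmod (m n) <= 1) (n : nat) :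
  dual_mult f m Hm (l1_basis n) = (m n * f (l1_basis n))%C.
Proof.
refine (eq_trans (f_equal f _) (dual_mul f (m n) (l1_basis n))).
apply l1_ext; intros k; simpl.
destruct (Nat.eqb_spec k n); [subst|]; ring.
Qed.

(** * Flat directions *)

(** The second condition is what makes c + s p and c - s p leave the closed unit
    disc only to second order in s: on the circle it says that p is tangent to it,
    and inside it allows p a radial part of size up to (1 - |c|^2) / |c|. *)
Definition tangent (c p : C) : Prop :=
  Cmod p <= 1 /\ Rabs (Re (Cconj c * p)%C) <= 1 - Cmod c ^ 2.

Lemma tangent_opp (c p : C) : tangent c p -> tangent c (- p)%C.
Proof.
intros [H1 H2]; split; [rewrite Cmod_opp; exact H1|].
replace (Cconj c * - p)%C with (- (Cconj c * p))%C by ring.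
change (Re (- (Cconj c * p))%C) with (- Re (Cconj c * p)%C).
rewrite Rabs_Ropp; exact H2.
Qed.

(** The square |c + s p|^2 is at most |c|^2 + 2 s (1 - |c|^2) + s^2, and
    2 s <= 1 bounds this by 1 + s^2. *)
Lemma tangent_step (c p : C) (s : R) :
  0 <= s <= / 2 -> tangent c p -> Cmod (c + RtoC s * p)%C <= 1 + s ^ 2.
Proof.
intros Hs [H1 H2].
apply Cmod_le_of_sqr; [nra|].
assert (H3 : Cmod p ^ 2 <= 1) by (pose proof (Cmod_ge_0 p); simpl; nra).
pose proof (Rle_trans _ _ _ (Rabs_pos _) H2) as H0.
pose proof (Rle_trans _ _ _ (Rle_abs _) H2) as H4.
rewrite Cmod2_alt in H0, H3, H4.
destruct c as [c1 c2], p as [p1 p2]; simpl in *.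
set (r := c1 * (c1 * 1) + c2 * (c2 * 1)) in *.
set (q := c1 * p1 - - c2 * p2) in *.
assert (H5 : 2 * s * q <= 2 * s * (1 - r)) by (apply Rmult_le_compat_l; lra).
assert (H6 : 2 * s * (1 - r) <= 1 * (1 - r)) by (apply Rmult_le_compat_r; lra).
assert (H7 : s ^ 2 * (p1 * (p1 * 1) + p2 * (p2 * 1)) <= s ^ 2 * 1)
  by (apply Rmult_le_compat_l; [apply pow2_ge_0|exact H3]).
pose proof (pow2_ge_0 (s ^ 2)).
apply Rle_trans with (r + 2 * s * q + s ^ 2 * (p1 * (p1 * 1) + p2 * (p2 * 1)));
  [right; unfold r, q; ring|].
apply Rle_trans with (1 + s ^ 2); [lra|].
pose proof (pow2_ge_0 s); nra.
Qed.

(** Subtracting u c removes the radial part of d up to the factor 1 - |c|^2, and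
    i u c is orthogonal to c. *)
Lemma tangent_decomposition (c d : C) :
  Cmod c <= 1 -> Cmod d <= 1 ->
  let u := Re (Cconj c * d)%C in
  tangent c (d - RtoC u * c)%C /\ tangent c (Ci * (RtoC u * c))%C.
Proof.
intros Hc Hd u.
pose proof (Cmod_ge_0 c); pose proof (Cmod_ge_0 d).
assert (Hc' : Cmod c ^ 2 <= 1) by (simpl; nra).
assert (Hd' : Cmod d ^ 2 <= 1) by (simpl; nra).
assert (Hu : Rabs u <= 1).
{ eapply Rle_trans; [apply re_le_Cmod|].
  rewrite Cmod_mult, Cmod_conj; nra. }
assert (Er : Re (Cconj c * (d - RtoC u * c))%C = u * (1 - Cmod c ^ 2)).
{ rewrite Cmod2_alt; unfold u; destruct c, d; simpl; ring. }
assert (Ei : Re (Cconj c * (Ci * (RtoC u * c)))%C = 0).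
{ clearbody u; destruct c; simpl; ring. }
split; split.
- apply Cmod_le_of_sqr; [lra|].
  replace (Re (d - RtoC u * c)%C ^ 2 + Im (d - RtoC u * c)%C ^ 2)
    with (Cmod d ^ 2 - u ^ 2 * (2 - Cmod c ^ 2))
    by (rewrite !Cmod2_alt; unfold u; destruct c, d; simpl; ring).
  pose proof (pow2_ge_0 u); nra.
- rewrite Er, Rabs_mult, (Rabs_pos_eq (1 - Cmod c ^ 2)) by lra; nra.
- rewrite !Cmod_mult, Cmod_Ci, Cmod_R; pose proof (Rabs_pos u); nra.
- rewrite Ei, Rabs_R0; lra.
Qed.

Lemma l1_bidual_tangent_bound (z y : dual (dual_NormedModule l1_NormedModule))
    (xi p : dual l1_NormedModule) (eps s : R) :
  (forall l : C, Cmod l <= 1 -> dual_norm _ (dual_plus _ z (dual_scal _ l y)) <= 1) ->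
  1 - eps <= Re (z xi) -> 0 <= s <= / 2 ->
  (forall n, tangent (xi (l1_basis n)) (p (l1_basis n))) ->
  s * Cmod (y p) <= eps + s ^ 2.
Proof.
intros Hdisc Hxi Hs Hp.
apply (disc_perturbation_bound z y xi p eps s Hdisc Hxi); [lra| |];
  apply l1_dual_norm_le; try nra; intros n.
- exact (tangent_step _ _ s Hs (Hp n)).
- change (Cmod (xi (l1_basis n) + RtoC (- s) * p (l1_basis n))%C <= 1 + s ^ 2).
  replace (RtoC (- s) * p (l1_basis n))%C
    with (RtoC s * - p (l1_basis n))%C by (rewrite RtoC_opp; ring).
  exact (tangent_step _ _ s Hs (tangent_opp _ _ (Hp n))).
Qed.

(** The coordinatewise decomposition of [tangent_decomposition], carried out by
    multiplying xi with the real sequence u: p = eta - u xi and q = i u xi. *)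
Lemma l1_dual_tangent_split (xi eta : dual l1_NormedModule) :
  dual_norm _ xi <= 1 -> dual_norm _ eta <= 1 ->
  exists p q : dual l1_NormedModule,
    (forall n, tangent (xi (l1_basis n)) (p (l1_basis n))) /\
    (forall n, tangent (xi (l1_basis n)) (q (l1_basis n))) /\
    eta = dual_plus _ p (dual_scal _ (- Ci)%C q).
Proof.
intros Hxi Heta.
set (c := fun n => xi (l1_basis n)).
set (d := fun n => eta (l1_basis n)).
assert (Hc : forall n, Cmod (c n) <= 1).
{ intros n; eapply Rle_trans; [apply l1_dual_basis_le|exact Hxi]. }
assert (Hd : forall n, Cmod (d n) <= 1).
{ intros n; eapply Rle_trans; [apply l1_dual_basis_le|exact Heta]. }
set (u := fun n => RtoC (Re (Cconj (c n) * d n)%C)).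
assert (Hu : forall n, Cmod (u n) <= 1).
{ intros n; unfold u; rewrite Cmod_R.
  eapply Rle_trans; [apply re_le_Cmod|].
  rewrite Cmod_mult, Cmod_conj.
  pose proof (Hc n); pose proof (Hd n); pose proof (Cmod_ge_0 (c n));
    pose proof (Cmod_ge_0 (d n)); nra. }
set (r := dual_mult xi u Hu).
exists (dual_plus _ eta (dual_opp _ r)), (dual_scal _ Ci r).
assert (Er : forall n, r (l1_basis n) = (u n * c n)%C).
{ intros n; apply dual_mult_basis. }
split; [|split].
- intros n.
  change (tangent (c n) (d n + (-1) * r (l1_basis n))%C); rewrite Er.
  replace (d n + (-1) * (u n * c n))%C with (d n - u n * c n)%C by ring.
  apply (tangent_decomposition (c n) (d n) (Hc n) (Hd n)).
- intros n.
  change (tangent (c n) (Ci * r (l1_basis n))%C); rewrite Er.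
  apply (tangent_decomposition (c n) (d n) (Hc n) (Hd n)).
- apply dual_ext; intros x.
  change (eta x = (eta x + (-1) * r x) + - Ci * (Ci * r x))%C.
  assert (Ei : (Ci * Ci)%C = RtoC (-1)).
  { unfold Ci, Cmult, RtoC; simpl; f_equal; ring. }
  replace (- Ci * (Ci * r x))%C with (- (Ci * Ci) * r x)%C by ring.
  rewrite Ei; ring.
Qed.

(** * Complex extreme points of the bidual ball *)

(** With a defect eps = s^2 of xi from norming z, every tangent direction v at xi
    has |y(v)| <= 2 s, so |y(eta)| <= 4 s. *)
Theorem l1_bidual_norm1_complex_extreme
    (z : dual (dual_NormedModule l1_NormedModule)) :
  dual_norm _ z = 1 ->
  complex_extreme (V := l1_bidual) closed_unit_ball z.
Proof.
intros Hz; split; [right; exact Hz|].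
intros y Hy.
change (forall l : C, Cmod l <= 1 ->
  dual_norm _ (dual_plus _ z (dual_scal _ l y)) <= 1) in Hy.
apply (dual_norm_eq0 _ y), Rle_antisym; [|apply dual_norm_ge0].
apply dual_norm_of_bound; intros eta Heta.
change (Cmod ((y : dual (dual_NormedModule l1_NormedModule)) eta) <= 0).
set (Y := (y : dual (dual_NormedModule l1_NormedModule))) in *.
apply le_epsilon; intros e He.
(* s <= 1/2 is required along flat directions; the final estimate is 4 s <= e. *)
set (s := Rmin (/ 2) (e / 4)).
assert (Hs : 0 < s) by (apply Rmin_pos; lra).
assert (Hs2 : s <= / 2) by apply Rmin_l.
assert (Hse : s <= e / 4) by apply Rmin_r.
destruct (dual_almost_norming z (s ^ 2)) as [xi [Hxi Hzxi]]; [nra|].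
change (dual_norm _ (xi : dual l1_NormedModule) <= 1) in Hxi.
rewrite Hz in Hzxi.
destruct (l1_dual_tangent_split xi eta Hxi Heta) as [p [q [Hp [Hq E]]]].
assert (Hb : forall v : dual l1_NormedModule,
  (forall n, tangent ((xi : dual l1_NormedModule) (l1_basis n)) (v (l1_basis n))) ->
  Cmod (Y v) <= 2 * s).
{ intros v Hv.
  pose proof (l1_bidual_tangent_bound z Y xi v (s ^ 2) s Hy Hzxi
                (conj (Rlt_le _ _ Hs) Hs2) Hv) as H.
  apply Rmult_le_reg_l with s; [exact Hs|nra]. }
assert (EY : Y eta = (Y p + - Ci * Y q)%C).
{ rewrite E.
  exact (eq_trans (dual_add Y p (dual_scal _ (- Ci)%C q))
           (f_equal (Cplus (Y p)) (dual_mul Y (- Ci)%C q))). }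
rewrite EY.
eapply Rle_trans; [apply Cmod_triangle|].
rewrite Cmod_mult, Cmod_opp, Cmod_Ci.
pose proof (Hb p Hp); pose proof (Hb q Hq); lra.
Qed.

Lemma l1_coord_linear (n : nat) : is_linear (fun x : l1_NormedModule => (x : l1) n).
Proof.
split; [reflexivity|reflexivity|].
exists 1; split; [lra|intros x].
rewrite Rmult_1_l; exact (l1_norm_coord x n).
Qed.

Definition l1_coord (n : nat) : dual l1_NormedModule := Dual _ _ (l1_coord_linear n).

(** Inside the ball any nonzero direction fits; the evaluation at a basis vector
    is one, as the corresponding coordinate functional shows. *)
Theorem l1_bidual_complex_extreme_norm1
    (z : dual (dual_NormedModule l1_NormedModule)) :
  complex_extreme (V := l1_bidual) closed_unit_ball z -> dual_norm _ z = 1.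
Proof.
intros [Hz Hext].
change (dual_norm _ z <= 1) in Hz.
apply Rle_antisym; [exact Hz|].
apply Rnot_lt_le; intros Hlt.
set (e := evaluation (V := l1_NormedModule) (l1_basis 0)).
assert (He : dual_norm _ e <= 1).
{ apply evaluation_norm_le1; right; apply l1_norm_basis. }
set (t := 1 - dual_norm _ z) in *.
assert (Hy : dual_scal _ (RtoC t) e = dual_zero _).
{ apply Hext; intros l Hl.
  change (dual_norm _ (dual_plus _ z (dual_scal _ l (dual_scal _ (RtoC t) e))) <= 1).
  eapply Rle_trans; [apply dual_norm_plus|].
  pose proof (dual_norm_scal _ l (dual_scal _ (RtoC t) e)) as H1.
  pose proof (dual_norm_scal _ (RtoC t) e) as H2.
  rewrite Cmod_R, Rabs_pos_eq in H2 by (unfold t; lra).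
  pose proof (dual_norm_ge0 _ (dual_scal _ (RtoC t) e)).
  pose proof (Cmod_ge_0 l).
  assert (t * dual_norm _ e <= t * 1) by (apply Rmult_le_compat_l; unfold t; lra).
  unfold t in *; nra. }
apply (f_equal (fun v : dual (dual_NormedModule l1_NormedModule) => v (l1_coord 0)))
  in Hy.
change ((RtoC t * 1)%C = 0%C) in Hy; rewrite Cmult_1_r in Hy.
injection Hy; unfold t; lra.
Qed.

Theorem corollary4p9 :
  (forall z : l1_bidual, complex_extreme closed_unit_ball z <-> unit_sphere z) /\
  (forall (z : l1_bidual) (phi : spectrum l1_NormedModule),
     unit_sphere z -> fiber z phi ->
     forall w : l1_bidual, closed_unit_ball w -> w <> z ->
       ~ exists psi : spectrum l1_NormedModule,
           gleason_part phi psi /\ fiber w psi).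
Proof.
split.
- intros z; split.
  + exact (l1_bidual_complex_extreme_norm1 z).
  + exact (l1_bidual_norm1_complex_extreme z).
- intros z phi Hz Hphi w _ Hwz [psi [Hpart Hpsi]].
  exact (Hwz (gleason_part_complex_extreme_fiber z w phi psi
                (l1_bidual_norm1_complex_extreme z Hz) Hphi Hpsi Hpart)).
Qed.
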